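(* Let $1\le s\le n-1$, $A\in M_{s+1,n-s}(\mathbb R)$, and consider the affine map $\mathbb R^s\to\mathbb R^n$, $\mathbf x\mapsto(\mathbf x,\tilde{\mathbf x}A)$, where $\tilde{\mathbf x}=(1,x_1,\dots,x_s)$. Suppose that either (1) $s=n-1$, or (2) $s=1$ and the first row of $A$ is zero, i.e. $A=\begin{pmatrix}0\\ \mathbf b\end{pmatrix}$ for a row vector $\mathbf b\in\mathbb R^{n-1}$. Then this map is extremal if and only if $A\notin\mathcal W^+_n(s+1,n-s)$.
   Context: Norms are sup-norms. For $A\in M_{m,k}(\mathbb R)$ and $v>0$, $A\in\mathcal W_v(m,k)$ means there are infinitely many $\mathbf q\in\mathbb Z^k$ (column vectors) with $\|A\mathbf q+\mathbf p\|\le\|\mathbf q\|^{-v}$ for some $\mathbf p\in\mathbb Z^m$; $\mathcal W_v^+(m,k)=\bigcup_{u>v}\mathcal W_u(m,k)$. A row vector $\mathbf y\in\mathbb R^n$ is very well approximable (VWA) if $\mathbf y\in\mathcal W_v(1,n)$ for some $v>n$. A map $\mathbf f$ from an open subset of $\mathbb R^d$ to $\mathbb R^n$ is extremal if $\mathbf f(\mathbf x)$ is not VWA for Lebesgue-a.e. $\mathbf x$. *)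

(* Defs.v *)
From HB Require Import structures.
From mathcomp Require Import all_boot all_order all_algebra.
From mathcomp Require Import all_classical all_reals all_analysis.
Set Implicit Arguments. Unset Strict Implicit. Unset Printing Implicit Defensive.
Import Order.TTheory GRing.Theory Num.Theory.
Local Open Scope classical_set_scope.
Local Open Scope ring_scope.

Definition supnorm (R : realType) (m k : nat) (M : 'M[R]_(m, k)) : R :=
  \big[Num.max/0]_(i < m) \big[Num.max/0]_(j < k) `|M i j|.

Definition intmx (R : realType) (m k : nat) (M : 'M[int]_(m, k)) : 'M[R]_(m, k) :=
  map_mx (fun z : int => z%:~R) M.

Definition W_set (R : realType) (m k : nat) (v : R) (A : 'M[R]_(m, k)) : Prop :=
  ~ finite_set [set q : 'cV[int]_k | exists p : 'cV[int]_m,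
      supnorm (A *m intmx R q + intmx R p) <= powR (supnorm (intmx R q)) (- v)].

Definition W_plus (R : realType) (m k : nat) (v : R) (A : 'M[R]_(m, k)) : Prop :=
  exists u : R, v < u /\ W_set u A.

Definition VWA (R : realType) (n : nat) (y : 'rV[R]_n) : Prop :=
  exists v : R, (n%:R < v) /\ W_set v y.

Definition lebesgue_null (R : realType) (d : nat) (N : set 'rV[R]_d) : Prop :=
  forall eps : R, 0 < eps ->
  exists a b : nat -> 'rV[R]_d,
    (forall k i, a k ord0 i <= b k ord0 i) /\
    (N `<=` \bigcup_k [set x | forall i, a k ord0 i <= x ord0 i <= b k ord0 i]) /\
    (forall K : nat, \sum_(k < K) \prod_(i < d) (b k ord0 i - a k ord0 i) <= eps).

Definition extremal (R : realType) (d n : nat) (f : 'rV[R]_d -> 'rV[R]_n) : Prop :=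
  lebesgue_null [set x | VWA (f x)].

Definition affine_map (R : realType) (s t : nat) (A : 'M[R]_(s.+1, t))
  (x : 'rV[R]_s) : 'rV[R]_(s + t) :=
  row_mx x (row_mx (1 : 'rV[R]_1) x *m A).

(* Main.v *)
(* Writing w(q) for the linear part of the affine form x |-> f(x) q, the point
   f(x) is very well approximable iff x lies in infinitely many of the slabs
   |p + c(q) + x . w(q)| <= |q|^-v for some v > n. Within a bounded box the union
   over p of these slabs has measure O(|q|^-v (1 + 1 / |w(q)|)), so by
   Borel-Cantelli it suffices to sum |q|^-v / |w(q)| over those q whose slab meets
   the box. The sum over the q with |w(q)| bounded below converges since v > n.
   On a line through the origin, a small w(q) forces p = 0, contradicting
   A \notin W_n^+ for large q as long as x stays away from 0. On a hyperplane,
   a small w(q) determines q from its last coordinate z, and A \notin W_n^+ says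
   that the z with |w(q)| <= 2^-i are separated by gaps of size about 2^(i/u),
   which makes the sum of |z|^-v / |w(q)| converge. Conversely a solution q for A
   gives a solution (p', q) for f(x), for every x, and the whole space is not
   null. *)

Require Import Defs.
From HB Require Import structures.
From mathcomp Require Import all_boot all_order all_algebra.
From mathcomp Require Import all_classical all_reals all_analysis.
From mathcomp Require Import measurable_realfun.
From mathcomp Require Import ring lra zify.
Import Order.TTheory GRing.Theory Num.Theory.
Local Open Scope ring_scope.

Set Implicit Arguments.
Unset Strict Implicit.
Unset Printing Implicit Defensive.
Local Open Scope classical_set_scope.

(** * Covers by boxes *)

Definition box (R : realType) (d : nat) (a b : 'rV[R]_d) : set 'rV[R]_d :=
  [set x | forall i, a ord0 i <= x ord0 i <= b ord0 i].

Definition vol (R : realType) (d : nat) (a b : 'rV[R]_d) : R :=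
  \prod_(i < d) (b ord0 i - a ord0 i).

(** A quantitative form of [lebesgue_null]: it bounds the outer measure of [N] by [c], and such
    bounds add up over countable unions. *)
Definition covered (R : realType) (d : nat) (N : set 'rV[R]_d) (c : R) : Prop :=
  exists a b : nat -> 'rV[R]_d,
    [/\ forall k i, a k ord0 i <= b k ord0 i,
        N `<=` \bigcup_k box (a k) (b k) &
        forall K : nat, \sum_(k < K) vol (a k) (b k) <= c].

Lemma lebesgue_nullE (R : realType) (d : nat) (N : set 'rV[R]_d) :
  lebesgue_null N <-> forall eps, 0 < eps -> covered N eps.
Proof.
split=> H eps e0; have [a [b]] := H _ e0.
- by move=> [h1 [h2 h3]]; exists a, b.
- by move=> [h1 h2 h3]; exists a, b.
Qed.

Lemma vol_ge0 (R : realType) (d : nat) (a b : 'rV[R]_d) :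
  (forall i, a ord0 i <= b ord0 i) -> 0 <= vol a b.
Proof. by move=> h; apply: prodr_ge0 => i _; rewrite subr_ge0. Qed.

Lemma ler_sum_uniq_sub (R : realType) (I : eqType) (s s' : seq I) (F : I -> R) :
  uniq s -> {subset s <= s'} -> (forall i, 0 <= F i) ->
  \sum_(i <- s) F i <= \sum_(i <- s') F i.
Proof.
move=> us; elim: s us s' => [|x s IH] /= us s' ss' F0.
  by rewrite big_nil sumr_ge0.
have xs' : x \in s' by apply: ss'; rewrite mem_head.
case/andP: us => xs us.
rewrite (perm_big _ (perm_to_rem xs')) /= !big_cons lerD2l; apply: IH => // y ys.
have : y \in s' by apply: ss'; rewrite inE ys orbT.
rewrite (perm_mem (perm_to_rem xs')) inE => /orP[/eqP yx|//].
by rewrite -yx ys in xs.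
Qed.

Lemma covered_countable (R : realType) (d : nat) (I : countType)
    (a b : I -> 'rV[R]_d.+1) (N : set 'rV[R]_d.+1) (c : R) :
  (forall k i, a k ord0 i <= b k ord0 i) ->
  (forall x, N x -> exists k, box (a k) (b k) x) ->
  (forall l : seq I, uniq l -> \sum_(k <- l) vol (a k) (b k) <= c) ->
  covered N c.
Proof.
move=> ab Nab lc.
(* Numbers that code no index get the one-point box at 0; its volume is 0 because the dimension is
   positive. *)
pose f (u : I -> 'rV[R]_d.+1) (k : nat) := if pickle_inv k is Some i then u i else 0.
exists (f a), (f b); split.
- by move=> k i; rewrite /f; case: (pickle_inv k).
- move=> x /Nab[k kx]; exists (pickle k) => //.
  by rewrite /f pickleK_inv.
- move=> K; pose l := pmap (@pickle_inv I) (iota 0 K).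
  apply: le_trans (lc l _); last first.
    rewrite (pmap_uniq (g := pickle)) ?iota_uniq//.
    by move=> n; apply: pickle_invK.
  rewrite -(big_mkord xpredT (fun k => vol (f a k) (f b k))) /index_iota subn0 /l.
  elim: (iota 0 K) => [|k s IH]; first by rewrite !big_nil.
  rewrite big_cons /= /f; case: (pickle_inv k) => [i|] /=; first by rewrite big_cons lerD2l.
  by rewrite /vol big_ord_recl subrr mul0r add0r.
Qed.

(** Volumes are nonnegative, so a sum over distinct indices is dominated by an initial partial
    sum. *)
Lemma covered_uniq (R : realType) (d : nat) (N : set 'rV[R]_d) (c : R) :
  covered N c -> exists a b : nat -> 'rV[R]_d,
    [/\ forall k i, a k ord0 i <= b k ord0 i,
        forall x, N x -> exists k, box (a k) (b k) x &
        forall l : seq nat, uniq l -> \sum_(k <- l) vol (a k) (b k) <= c].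
Proof.
move=> [a [b [ab Nab Kc]]]; exists a, b; split=> //.
  by move=> x /Nab[k _ kx]; exists k.
move=> l ul; apply: le_trans (Kc (\max_(i <- l) i).+1).
rewrite -(big_mkord xpredT (fun k => vol (a k) (b k))) /index_iota subn0.
apply: ler_sum_uniq_sub => // [i il|i]; last exact: vol_ge0.
by rewrite mem_iota add0n ltnS /=; apply: leq_bigmax_seq.
Qed.

Lemma covered_bigcup (R : realType) (d : nat) (I : countType)
    (N : I -> set 'rV[R]_d.+1) (c : I -> R) (C : R) :
  (forall i, covered (N i) (c i)) ->
  (forall l : seq I, uniq l -> \sum_(i <- l) c i <= C) ->
  covered [set x | exists i, N i x] C.
Proof.
move=> Nc lC.
have /choice[a /choice[b H]] := fun i => covered_uniq (Nc i).
apply: (@covered_countable _ _ (I * nat)%type (fun k => a k.1 k.2) (fun k => b k.1 k.2)).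
- by move=> [i k]; case: (H i).
- by move=> x [i Nx]; case: (H i) => _ /(_ _ Nx)[k kx] _; exists (i, k).
move=> l ul.
(* A finite set of pairs lies in the product of its two projections, where the sum is an iterated
   one. *)
pose l1 := undup [seq p.1 | p <- l]; pose l2 := undup [seq p.2 | p <- l].
apply: le_trans (lC l1 (undup_uniq _)).
apply: le_trans (_ : _ <= \sum_(i <- l1) \sum_(k <- l2) vol (a i k) (b i k)) _; last first.
  by apply: ler_sum => i _; case: (H i) => _ _; apply; exact: undup_uniq.
rewrite -(big_allpairs (F := fun p => vol (a p.1 p.2) (b p.1 p.2))) /=.
apply: ler_sum_uniq_sub => //; last by move=> [i k]; apply: vol_ge0; case: (H i).
move=> [i k] il; apply: allpairs_f; rewrite mem_undup.
  by apply/mapP; exists (i, k).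
by apply/mapP; exists (i, k).
Qed.

Lemma coveredS (R : realType) (d : nat) (M N : set 'rV[R]_d) (c : R) :
  M `<=` N -> covered N c -> covered M c.
Proof. by move=> MN [a [b [h1 h2 h3]]]; exists a, b; split=> //; apply: subset_trans h2. Qed.

Lemma covered_le (R : realType) (d : nat) (N : set 'rV[R]_d) (c c' : R) :
  c <= c' -> covered N c -> covered N c'.
Proof.
by move=> cc' [a [b [h1 h2 h3]]]; exists a, b; split=> // K; exact: le_trans (h3 K) cc'.
Qed.

Lemma covered_set0 (R : realType) (d : nat) : covered (set0 : set 'rV[R]_d.+1) 0.
Proof.
exists (fun=> 0), (fun=> 0); split=> [_ i|//|K]; first by rewrite lexx.
by rewrite big1// => k _; rewrite /vol big_ord_recl subrr mul0r.
Qed.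

Lemma covered_box (R : realType) (d : nat) (a b : 'rV[R]_d.+1) :
  (forall i, a ord0 i <= b ord0 i) -> covered (box a b) (vol a b).
Proof.
move=> ab; apply: (@covered_countable _ _ unit (fun=> a) (fun=> b)) => //.
move=> l ul; apply: (@le_trans _ _ (\sum_(k <- [:: tt]) vol a b)).
  by apply: ler_sum_uniq_sub => // _; rewrite vol_ge0.
by rewrite big_seq1.
Qed.

Lemma covered_fin (R : realType) (d : nat) (I : finType)
    (N : I -> set 'rV[R]_d.+1) (c : R) : 0 <= c ->
  (forall i, covered (N i) c) -> covered [set x | exists i, N i x] (#|I|%:R * c).
Proof.
move=> c0 Nc; apply: covered_bigcup Nc _ => l ul.
apply: le_trans (_ : \sum_(i <- index_enum I) c <= _).
  by apply: ler_sum_uniq_sub => // i _; exact: mem_index_enum.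
by rewrite big_const iter_addr addr0 mulr_natl.
Qed.

Lemma null_bigcup (R : realType) (d : nat) (N : nat -> set 'rV[R]_d.+1) :
  (forall k, lebesgue_null (N k)) -> lebesgue_null [set x | exists k, N k x].
Proof.
move=> N0; apply/lebesgue_nullE => eps e0.
apply: (@covered_bigcup _ _ nat N (fun k => eps * 2^-1 ^+ k.+1)).
  by move=> k; apply: (proj1 (lebesgue_nullE _) (N0 k)); rewrite mulr_gt0// exprn_gt0// invr_gt0.
move=> l ul.
pose K := (\max_(i <- l) i).+1.
apply: le_trans (_ : _ <= \sum_(i <- iota 0 K) eps * 2^-1 ^+ i.+1) _.
  apply: ler_sum_uniq_sub => // [i il|i].
    by rewrite mem_iota add0n ltnS /=; apply: leq_bigmax_seq.
  by rewrite mulr_ge0 ?(ltW e0)// exprn_ge0// invr_ge0.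
suff -> : \sum_(i <- iota 0 K) eps * 2^-1 ^+ i.+1 = eps * (1 - 2^-1 ^+ K).
  by rewrite ler_piMr ?(ltW e0)// gerBl exprn_ge0// invr_ge0.
have -> : iota 0 K = index_iota 0 K by rewrite /index_iota subn0.
elim: K => [|K IH]; first by rewrite big_geq// expr0 subrr mulr0.
by rewrite big_nat_recr//= IH exprS; field.
Qed.

Lemma null_sub (R : realType) (d : nat) (M N : set 'rV[R]_d) :
  M `<=` N -> lebesgue_null N -> lebesgue_null M.
Proof.
by move=> MN /lebesgue_nullE H; apply/lebesgue_nullE => e /H; exact: coveredS.
Qed.

(** A finite list whose sum comes within [eps] of the supremum of all finite sums leaves less than
    [eps] for any list disjoint from it. Dropping it loses no point that lies in infinitely many
    [E i]. *)
Lemma borel_cantelli (R : realType) (d : nat) (I : countType)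
    (E : I -> set 'rV[R]_d.+1) (c : I -> R) (C : R) :
  (forall i, covered (E i) (c i)) ->
  (forall l : seq I, uniq l -> \sum_(i <- l) c i <= C) ->
  lebesgue_null [set x | ~ finite_set [set i | E i x]].
Proof.
move=> Ec lC; apply/lebesgue_nullE => eps e0.
pose S : set R := [set y | exists2 l : seq I, uniq l & y = \sum_(i <- l) c i].
have S0 : S !=set0 by exists 0, [::] => //; rewrite big_nil.
have SC : has_ubound S by exists C => _ [l ul ->]; exact: lC.
have [_ [l0 ul0 ->] Hl0] := sup_adherent e0 (conj S0 SC).
pose E' i := if i \in l0 then set0 else E i.
pose c' i := if i \in l0 then 0 else c i.
apply: coveredS (_ : _ `<=` [set x | exists i, E' i x]) _.
  move=> x /= Einf; apply: contrapT => nE; apply: Einf.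
  apply: sub_finite_set (finite_seq l0) => i /= Ei.
  by apply: contrapT => il0; apply: nE; exists i; rewrite /E'; case: ifPn.
apply: (@covered_bigcup _ _ _ _ c').
  by move=> i; rewrite /E' /c'; case: ifP => // _; exact: covered_set0.
move=> l ul; rewrite (bigID (fun i => i \in l0)) /= big1 ?add0r; last first.
  by move=> i il; rewrite /c' il.
rewrite (eq_bigr c); last by move=> i /negbTE il; rewrite /c' il.
have : \sum_(i <- l0 ++ [seq i <- l | i \notin l0]) c i <= sup S.
  apply: ub_le_sup => //; eexists; last by [].
  rewrite cat_uniq ul0 filter_uniq//= andbT.
  by apply/hasPn => i; rewrite mem_filter => /andP[].
rewrite big_cat big_filter /=; lra.
Qed.

(** * Covering slabs *)

Lemma exists_cell (R : realType) (M : nat) (h t : R) :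
  0 < h -> (0 < M)%N -> 0 <= t <= M%:R * h ->
  exists k : 'I_M, k%:R * h <= t <= (k%:R + 1) * h.
Proof.
move=> h0 M0 /andP[t0 tM].
have [tlt|] := ltP t (M%:R * h).
  have th : 0 <= t / h by rewrite divr_ge0 ?(ltW h0).
  have kM : (Num.truncn (t / h)%R < M)%N by rewrite truncn_lt_nat// ltr_pdivrMr.
  exists (Ordinal kM) => /=.
  have /andP[k1 k2] := truncn_itv th.
  by rewrite -ler_pdivlMr// k1 -ler_pdivrMr//= -natr1 in k2 * ; rewrite ltW.
move=> Mt; have kM : (M.-1 < M)%N by rewrite prednK.
exists (Ordinal kM) => /=; rewrite natr1 prednK// tM andbT (le_trans _ Mt)// ler_pM2r//.
by rewrite ler_nat leq_pred.
Qed.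

(* After slicing along the coordinates other than [i] into cells so thin that
   the affine form varies by at most [del] on each, the slab becomes one
   interval of length [4 * del / m] in the [i]-th coordinate over each cell. *)
Lemma covered_slab (R : realType) (d : nat) (B c m del : R) (w : 'cV[R]_d.+1)
    (i : 'I_d.+1) :
  0 < B -> 0 < del -> 0 < m -> `|w i ord0| = m -> (forall j, `|w j ord0| <= m) ->
  covered [set x : 'rV[R]_d.+1 | (forall j, `|x ord0 j| <= B) /\
             `|c + \sum_j x ord0 j * w j ord0| <= del]
          ((2 * B) ^+ d * (4 * del / m)).
Proof.
move=> B0 del0 m0 wi wm.
have wi0 : w i ord0 != 0 by rewrite -normr_gt0 wi.
(* Cutting [[-B, B]] into [M >= T] cells of length [h] gives [d * h * m <= del]. *)
pose T := 2 * B * d%:R * m / del.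
have T0 : 0 <= T by rewrite divr_ge0 ?(ltW del0)// !mulr_ge0 ?(ltW B0)// (ltW m0).
pose M := (Num.truncn T).+1.
have M0 : 0 < M%:R :> R by rewrite ltr0n.
have TM : T <= M%:R by have /andP[_ /ltW] := truncn_itv T0.
pose h := 2 * B / M%:R.
have h0 : 0 < h by rewrite divr_gt0// mulr_gt0.
have hd : d%:R * (h * m) <= del.
  rewrite /h; have -> : d%:R * (2 * B / M%:R * m) = T / M%:R * del.
    by rewrite /T; field; rewrite !gt_eqF.
  by rewrite ler_piMl ?(ltW del0)// ler_pdivrMr// mul1r.
have dm0 : 0 < del / m by rewrite divr_gt0.
pose y (g : {ffun 'I_d -> 'I_M}) j : R := - B + (g j)%:R * h.
(* The [i]-th coordinate at which the form vanishes when the others sit at the corner [y g]. *)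
pose ctr g := - (c + \sum_j y g j * w (lift i j) ord0) / w i ord0.
pose a g : 'rV[R]_d.+1 :=
  \row_k (if unlift i k is Some j then y g j else ctr g - 2 * (del / m)).
pose b g : 'rV[R]_d.+1 :=
  \row_k (if unlift i k is Some j then y g j + h else ctr g + 2 * (del / m)).
have ab g j : a g ord0 j <= b g ord0 j.
  rewrite !mxE; case: (unlift i j) => [k|]; first by rewrite lerDl ltW.
  by rewrite lerD2l -subr_ge0; lra.
have volE g : vol (a g) (b g) = 4 * del / m * h ^+ d.
  rewrite /vol (bigD1_ord i)//= !mxE unlift_none; congr (_ * _); first by field; rewrite gt_eqF.
  transitivity (\prod_(j < d) h); last by rewrite prodr_const card_ord.
  by apply: eq_bigr => j _; rewrite !mxE liftK; ring.
have cvd : covered [set x | exists g, box (a g) (b g) x]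
    (#|{: {ffun 'I_d -> 'I_M}}|%:R * (4 * del / m * h ^+ d)).
  apply: covered_fin => [|g]; last by rewrite -(volE g); exact: covered_box.
  by rewrite mulr_ge0 ?exprn_ge0 ?(ltW h0)//; lra.
apply: coveredS (covered_le _ cvd); last first.
  rewrite card_ffun !card_ord natrX mulrCA mulrC -exprMn.
  by rewrite (_ : M%:R * h = 2 * B)// /h; field; rewrite gt_eqF.
move=> x /= [xB xd].
have /choice[g gP] : forall j : 'I_d, exists k : 'I_M,
    k%:R * h <= x ord0 (lift i j) + B <= (k%:R + 1) * h.
  move=> j; apply: exists_cell => //.
  have -> : M%:R * h = 2 * B by rewrite /h; field; rewrite gt_eqF.
  by have := xB (lift i j); rewrite ler_norml; lra.
exists (finfun g) => k; rewrite !mxE.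
case: unliftP => [j ->|->].
  by have := gP j; rewrite /y ffunE; lra.
have yx j : `|x ord0 (lift i j) - y (finfun g) j| <= h.
  by rewrite ler_norml /y ffunE; have := gP j; lra.
rewrite -ler_distl.
have -> : x ord0 i - ctr (finfun g) =
    (x ord0 i * w i ord0 + c + \sum_j y (finfun g) j * w (lift i j) ord0) / w i ord0.
  by rewrite /ctr; field.
rewrite normrM normfV wi mulrA ler_pM2r ?invr_gt0//.
(* Moving the other coordinates from the corner to [x] costs at most [d * h * m <= del], which adds
   to the width [del] of the slab. *)
have -> : x ord0 i * w i ord0 + c + \sum_j y (finfun g) j * w (lift i j) ord0 =
   (c + \sum_j x ord0 j * w j ord0)
   - \sum_j (x ord0 (lift i j) - y (finfun g) j) * w (lift i j) ord0.
  rewrite (bigD1_ord i)//=.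
  under [X in _ = _ - X]eq_bigr do rewrite mulrBl.
  by rewrite sumrB; ring.
apply: le_trans (ler_normB _ _) _.
have -> : 2 * del = del + del by ring.
apply: lerD => //; apply: le_trans (ler_norm_sum _ _ _) _; apply: le_trans hd.
apply: le_trans (_ : \sum_(j < d) h * m <= _).
  by apply: ler_sum => j _; rewrite normrM ler_pM.
by rewrite sumr_const card_ord mulr_natl.
Qed.

(** About [2 * r] integers [p] give a slab meeting the box, and each slab costs a multiple of
    [del / m]. As [r] is [1 + O(m)], the product is [O(del * (1 + 1 / m))]. *)
Lemma covered_near_int (R : realType) (d : nat) (B : R) : 0 < B ->
  exists2 C : R, 0 < C &
  forall (c m del : R) (w : 'cV[R]_d.+1) (i : 'I_d.+1),
  0 < del <= 1 -> 0 < m -> `|w i ord0| = m -> (forall j, `|w j ord0| <= m) ->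
  covered [set x : 'rV[R]_d.+1 | (forall j, `|x ord0 j| <= B) /\
             exists p : int, `|p%:~R + c + \sum_j x ord0 j * w j ord0| <= del]
          (C * (del * (1 + m^-1))).
Proof.
move=> B0.
have D0 : 0 < d.+1%:R * B by rewrite mulr_gt0.
have BX0 : 0 < (2 * B) ^+ d by rewrite exprn_gt0// mulr_gt0.
exists ((2 * B) ^+ d * 4 * (4 + 2 * (d.+1%:R * B))).
  by rewrite !mulr_gt0//; lra.
move=> c m del w i /andP[del0 del1] m0 wi wm.
(* A point of the box forces [|p + c| <= r], since [del <= 1] and the linear part is at most
   [d.+1 * B * m]. *)
pose r := 1 + d.+1%:R * B * m.
have Dm0 : 0 < d.+1%:R * B * m by rewrite mulr_gt0.
have r0 : 0 <= 2 * r + 1 by rewrite /r; lra.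
pose p0 := Num.floor (- c - r).
pose K := (Num.truncn (2 * r + 1)).+1.
have /andP[K1 K2] := truncn_itv r0.
pose N (k : 'I_K) := [set x : 'rV[R]_d.+1 | (forall j, `|x ord0 j| <= B) /\
  `|(p0%:~R + k%:R + c) + \sum_j x ord0 j * w j ord0| <= del].
have dm0 : 0 < del / m by rewrite divr_gt0.
have := @covered_fin R d 'I_K N ((2 * B) ^+ d * (4 * del / m)) _ (fun k => covered_slab _ B0 del0 m0 wi wm).
rewrite card_ord => cvd.
apply: coveredS (covered_le _ (cvd _)); last first.
- by rewrite mulr_ge0 ?(ltW BX0)//; lra.
- have -> : K%:R * ((2 * B) ^+ d * (4 * del / m)) = (2 * B) ^+ d * 4 * (K%:R * (del / m)).
    by rewrite -mulrA; ring.
  rewrite -[leRHS]mulrA; apply: ler_wpM2l; first by rewrite mulr_ge0 ?ltW.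
  rewrite /K -natr1 (@le_trans _ _ ((2 * r + 2) * (del / m)))//.
    by rewrite ler_pM2r//; lra.
  have -> : (2 * r + 2) * (del / m) = del * (4 * m^-1 + 2 * (d.+1%:R * B)).
    by rewrite /r; field; rewrite gt_eqF.
  have m'0 : 0 < m^-1 by rewrite invr_gt0.
  rewrite [leRHS]mulrCA; apply: ler_wpM2l; first exact: ltW.
  rewrite mulrDr mulr1 mulrDl.
  have : 0 < 2 * (d.+1%:R * B) * m^-1 by rewrite !mulr_gt0.
  by lra.
move=> x /= [xB [p xp]].
have sx : `|\sum_j x ord0 j * w j ord0| <= d.+1%:R * B * m.
  apply: le_trans (ler_norm_sum _ _ _) _.
  apply: le_trans (_ : \sum_(j < d.+1) B * m <= _).
    by apply: ler_sum => j _; rewrite normrM ler_pM.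
  by rewrite sumr_const card_ord -mulrA mulr_natl.
have /andP[f1 f2] := floor_itv (- c - r).
have p1 : - c - r <= p%:~R by move: sx xp; rewrite /r !ler_norml; lra.
have p2 : p%:~R <= - c + r by move: sx xp; rewrite /r !ler_norml; lra.
have p0p : (p0 <= p)%R by rewrite -(ler_int R); apply: le_trans p1.
have [k kE] : exists k : nat, p = p0 + k%:Z.
  by exists `|p - p0|%N; rewrite gez0_abs ?subr_ge0// addrCA subrr addr0.
have pk : p%:~R = p0%:~R + k%:R :> R by rewrite kE intrD.
have kK : (k < K)%N.
  rewrite -(ltr_nat R); apply: le_lt_trans K2.
  by rewrite intrD in f2; move: pk p2 f2; rewrite -/p0; lra.
by exists (Ordinal kK); split=> //=; rewrite -pk.
Qed.

(** * The whole space is not null *)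

(* Fubini by induction on the dimension, for a weighted family of boxes. *)
Lemma boxes_total_ge1 (R : realType) (n : nat) (a b : nat -> 'I_n -> R) (c : nat -> R) :
  (forall k i, a k i <= b k i) -> (forall k, 0 <= c k) ->
  (forall x : 'I_n -> R, (forall i, 0 <= x i <= 1) ->
     (1 <= \sum_(0 <= k <oo) (c k * \prod_i \1_(`[a k i, b k i]%classic) (x i))%:E)%E) ->
  (1 <= \sum_(0 <= k <oo) (c k * \prod_i (b k i - a k i))%:E)%E.
Proof.
elim: n a b c => [|n IH] a b c ab c0 H.
  have := H (fun=> 0); under eq_eseriesr do rewrite big_ord0.
  by under [X in _ -> (_ <= X)%E]eq_eseriesr do rewrite big_ord0; apply => -[].
pose P k := \prod_(i < n) (b k (lift ord0 i) - a k (lift ord0 i)).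
have P0 k : 0 <= P k by apply: prodr_ge0 => i _; rewrite subr_ge0.
pose I k : set (measurableTypeR R) := `[a k ord0, b k ord0]%classic.
(* For a fixed first coordinate [x0], its indicator is absorbed into the weights and the induction
   hypothesis handles the remaining coordinates. *)
have H1 x0 : 0 <= x0 <= 1 -> (1 <= \sum_(0 <= k <oo) ((c k * P k) * \1_(I k) x0)%:E)%E.
  move=> x01.
  have := IH (fun k i => a k (lift ord0 i)) (fun k i => b k (lift ord0 i))
             (fun k => c k * \1_(I k) x0).
  under [X in _ -> (_ <= X)%E]eq_eseriesr do rewrite mulrAC.
  apply => [k i|k|x x1]; first exact: ab.
    by rewrite mulr_ge0.
  have := H (fun i => if unlift ord0 i is Some j then x j else x0).
  under [X in (_ -> (_ <= X)%E) -> _]eq_eseriesr => k _.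
    rewrite big_ord_recl unlift_none mulrA.
    under eq_bigr do rewrite liftK.
    over.
  by apply=> i; case: (unlift ord0 i).
pose mu := @lebesgue_measure R.
pose D : set (measurableTypeR R) := `[0, 1]%classic.
have mD : measurable D by exact: measurable_itv.
have mI k : measurable (I k) by exact: measurable_itv.
have muD : mu D = 1%E by rewrite /mu /D lebesgue_measure_itv /= lte_fin ltr01 oppr0 adde0.
(* Next, [H1] is integrated over [x0] in [[0, 1]], and sum and integral are exchanged; each
   indicator integrates to at most the length of [I k]. *)
have -> : 1%E = (\int[mu]_(x in D) (cst 1%E x))%E by rewrite integral_cst// mul1e; symmetry; exact: muD.
pose f k (x : measurableTypeR R) : \bar R := ((c k * P k)%:E * (\1_(I k) x)%:E)%E.
have f0 k x : (0 <= f k x)%E by rewrite mule_ge0// lee_fin mulr_ge0.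
have mf k : measurable_fun D (f k).
  apply: emeasurable_funM => //; apply/measurable_EFinP.
  exact: measurable_indic.
apply: (@le_trans _ _ (\int[mu]_(x in D) (\sum_(0 <= k <oo) f k x))%E).
  apply: ge0_le_integral => //.
  exact: ge0_emeasurable_sum.
rewrite integral_nneseries//.
apply: lee_nneseries => [k _ _|k _]; first exact: integral_ge0.
rewrite ge0_integralZl_EFin//; last 2 first.
- by apply/measurable_EFinP; exact: measurable_indic.
- by rewrite mulr_ge0.
rewrite integral_indic// big_ord_recl mulrCA [X in (_ <= X)%E]EFinM muleC.
apply: lee_wpmul2r; first by rewrite lee_fin mulr_ge0.
apply: (@le_trans _ _ (mu (I k))); first by apply: le_measure; rewrite ?inE//; exact: measurableI.
rewrite /mu /I lebesgue_measure_itv /=; case: ifP => // _.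
by rewrite lee_fin subr_ge0.
Qed.

(** Boxes covering the space cover the unit cube, so their total volume is at least 1 and cannot be
    at most 1/2. *)
Lemma not_null_setT (R : realType) (d : nat) : ~ lebesgue_null (setT : set 'rV[R]_d).
Proof.
move=> /lebesgue_nullE /(_ 2^-1) [|a [b [ab Nab Kc]]]; first by rewrite invr_gt0.
have H : (1 <= \sum_(0 <= k <oo) (vol (a k) (b k))%:E)%E.
  rewrite [leRHS](_ : _ = \sum_(0 <= k <oo) (1 * \prod_i (b k ord0 i - a k ord0 i))%:E)%E; last first.
    by apply: eq_eseriesr => k _; rewrite mul1r.
  apply: (@boxes_total_ge1 R d (fun k => a k ord0) (fun k => b k ord0) (fun=> 1)) => // x _.
  have [k _ kx] := Nab (\row_i x i) I.
  apply: le_trans (nneseries_lim_ge k.+1 _); last first.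
    by move=> m _ _; rewrite lee_fin mul1r prodr_ge0.
  rewrite big_nat_recr//= -[leLHS]add0e; apply: leeD.
    by rewrite sume_ge0// => m _; rewrite lee_fin mul1r prodr_ge0.
  rewrite lee_fin mul1r big1// => i _.
  by rewrite indicE mem_set//= in_itv /=; have := kx i; rewrite !mxE.
have : (\sum_(0 <= k <oo) (vol (a k) (b k))%:E <= (2^-1 : R)%:E)%E.
  apply: lime_le; first by apply: is_cvg_nneseries => k _ _; rewrite lee_fin vol_ge0.
  by apply: nearW => K; rewrite sumEFin lee_fin big_mkord.
move=> /(le_trans H); rewrite lee_fin; lra.
Qed.

(** * Convergent sums *)

Lemma le_powRN (R : realType) (x y a : R) :
  0 <= a -> 0 < x -> x <= y -> y `^ (- a) <= x `^ (- a).
Proof.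
move=> a0 x0 xy; have y0 := lt_le_trans x0 xy.
rewrite !powRN lef_pV2 ?posrE ?powR_gt0//.
by rewrite ge0_ler_powR ?nnegrE ?(ltW x0) ?(ltW y0).
Qed.

Lemma sum_geometric_le (R : realType) (r : R) (n : nat) :
  0 <= r < 1 -> \sum_(i < n) r ^+ i <= (1 - r)^-1.
Proof.
move=> /andP[r0 r1]; rewrite -div1r ler_pdivlMr ?subr_gt0//.
rewrite mulrC -opprB mulNr -subrX1 opprB gerBl exprn_ge0//.
Qed.

(** The ratio 2^(1 - a) of the condensation argument below and of the dyadic levels in
    [sum_gap_inv_le]. *)
Lemma mul2_powRN_lt1 (R : realType) (a : R) : 1 < a -> 2 * 2 `^ (- a) < 1 :> R.
Proof.
move=> a1.
have -> : 2 * 2 `^ (- a) = (2 `^ (a - 1))^-1 :> R.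
  by rewrite -powRN opprB powRD ?powRr1// pnatr_eq0 implybT.
have e1 : 1 = 1 `^ (a - 1) :> R by rewrite powR1.
rewrite invf_lt1 ?powR_gt0// [ltLHS]e1.
by apply: gt0_ltr_powR; rewrite ?nnegrE ?subr_gt0 ?ltr1n.
Qed.

(* Condensation: comparing the terms [2 * k] and [2 * k + 1] with the term [k]
   bounds a partial sum [S] by [1 + 2 `^ (1 - a) * S]. *)
Lemma sum_nat_powRN_le (R : realType) (a : R) (n : nat) :
  1 < a -> \sum_(k < n) k.+1%:R `^ (- a) <= (1 - 2 * 2 `^ (- a))^-1 :> R.
Proof.
move=> a1; have a0 : 0 <= a by lra.
pose f k : R := k.+1%:R `^ (- a).
have f0 k : 0 <= f k by exact: powR_ge0.
(* Because [f] is shifted by one, the terms are (2k+2)^-a and (2k+3)^-a, compared with (k+1)^-a. *)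
have half k : f k.*2.+1 + f k.*2.+2 <= 2 * 2 `^ (- a) * f k.
  have h : f k.*2.+1 <= 2 `^ (- a) * f k.
    by rewrite /f -powRM// -natrM mul2n doubleS.
  have : f k.*2.+2 <= f k.*2.+1 by apply: le_powRN => //; rewrite ler_nat.
  by lra.
have S2 m : \sum_(k < m.*2.+1) f k <= 1 + 2 * 2 `^ (- a) * \sum_(k < m) f k.
  elim: m => [|m IH].
    by rewrite big_ord1 big_ord0 mulr0 addr0 /f powR1.
  rewrite doubleS 2!big_ord_recr /= [in leRHS]big_ord_recr /= mulrDr.
  by have := half m; lra.
have S1 : \sum_(k < n) f k <= \sum_(k < n.*2.+1) f k.
  rewrite -!(big_mkord xpredT f); apply: ler_sum_uniq_sub; rewrite ?iota_uniq// => i.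
  by rewrite !mem_index_iota; lia.
have r1 := mul2_powRN_lt1 a1.
rewrite -div1r ler_pdivlMr ?subr_gt0//.
by have := S2 n; rewrite /f in S1 *; lra.
Qed.

(** The cut-off at 1 gives the integer 0 the weight 1, so that a zero entry contributes a factor 1
    to a product over coordinates. *)
Lemma sum_int_powRN_le (R : realType) (a : R) : 1 < a ->
  exists2 C : R, 0 < C & forall l : seq int, uniq l ->
  \sum_(k <- l) (Num.max 1 `|k|%:~R) `^ (- a) <= C.
Proof.
move=> a1; pose Z : R := (1 - 2 * 2 `^ (- a))^-1.
pose h (k : int) : R := (Num.max 1 `|k|%:~R) `^ (- a).
have Z0 : 0 <= Z by apply: le_trans (sum_nat_powRN_le 0 a1); rewrite big_ord0.
exists (2 * (1 + Z)); first by lra.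
move=> l ul.
pose K := (\max_(i <- l) `|i|%N)%N.
apply: (@le_trans _ _ (\sum_(k <- map Posz (iota 0 K.+1) ++ map (fun i => - i%:Z) (iota 0 K.+1)) h k)).
  apply: ler_sum_uniq_sub => // k kl.
  have kK : (`|k| <= K)%N by apply: leq_bigmax_seq.
  rewrite mem_cat; apply/orP; have [k0|k0] := lerP 0 k; [left|right]; apply/mapP;
    exists `|k|%N; rewrite ?mem_iota//; lia.
have sK : \sum_(k <- iota 0 K.+1) h k%:Z <= 1 + Z.
  rewrite -[iota 0 K.+1]/(0%N :: iota 1 K) big_cons lerD//.
    by rewrite /h normr0 max_l// powR1.
  apply: le_trans (sum_nat_powRN_le K a1).
  rewrite (iotaDl 1 0 K) big_map -[iota 0 K](_ : index_iota 0 K = _); last first.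
    by rewrite /index_iota subn0.
  rewrite big_mkord; apply: ler_sum => k _.
  by rewrite /h add1n max_r// ler1n.
rewrite big_cat !big_map /=.
by under [X in _ + X]eq_bigr do rewrite /h normrN; rewrite -/(h _); lra.
Qed.

(** By the gaps, the cell numbers [k q = floor (z q / g)] are pairwise distinct, and [|z q|] is at
    least [g / 2] times the maximum of 1 and [|k q|]. This leaves a sum over distinct integers. *)
Lemma sum_gap_le (R : realType) (v : R) : 1 < v ->
  exists2 C : R, 0 < C & forall (T : eqType) (l : seq T) (z : T -> int) (g : R),
  uniq l -> 0 < g -> (forall q, q \in l -> g <= `|z q|%:~R) ->
  (forall q q', q \in l -> q' \in l -> q != q' -> g <= `|z q - z q'|%:~R) ->
  \sum_(q <- l) `|z q|%:~R `^ (- v) <= C * (g / 2) `^ (- v).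
Proof.
move=> v1; have v0 : 0 <= v by lra.
have [C C0 CP] := sum_int_powRN_le v1; exists C => // T l z g ul g0 gz gzz.
pose k q := Num.floor ((z q)%:~R / g).
have kP q : (k q)%:~R * g <= (z q)%:~R /\ (z q)%:~R < ((k q)%:~R + 1) * g.
  have /andP[] := floor_itv ((z q)%:~R / g); rewrite ler_pdivlMr// ltr_pdivrMr//.
  by rewrite intrD.
have uk : uniq (map k l).
  rewrite map_inj_in_uniq// => q q' ql q'l kk; apply/eqP/negPn/negP => qq'.
  have := gzz _ _ ql q'l qq'; have := kP q; have := kP q'; rewrite kk.
  by rewrite intr_norm intrB ler_normr; lra.
rewrite [leRHS]mulrC; apply: le_trans (ler_wpM2l (powR_ge0 _ _) (CP _ uk)).
rewrite big_map mulr_sumr big_seq [leRHS]big_seq; apply: ler_sum => q ql.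
have g20 : 0 < g / 2 by rewrite divr_gt0.
have m0 : 0 < Num.max 1 `|k q|%:~R :> R by rewrite lt_max ltr01.
rewrite -powRM ?(ltW g20) ?(ltW m0)//; apply: le_powRN => //; first exact: mulr_gt0.
have gq := gz _ ql.
rewrite maxr_pMr ?(ltW g20)// ge_max; apply/andP; split; first by lra.
have [k1 k2] := kP q.
have kg : `|(k q)%:~R * g| <= `|(z q)%:~R| + g.
  have : - `|(z q)%:~R : R| <= (z q)%:~R <= `|(z q)%:~R : R| by rewrite -ler_norml.
  by rewrite ler_norml; rewrite mulrDl in k2; lra.
rewrite normrM (gtr0_norm g0) in kg.
by move: gq kg; rewrite !intr_norm; lra.
Qed.

(** The largest [i] with d <= 2^-i has 2^-(i+1) < d, so its term alone dominates 1/d. *)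
Lemma inv_le_dyadic_sum (R : realType) (d : R) (n : nat) :
  0 < d <= 1 -> 2^-1 ^+ n < d ->
  d^-1 <= \sum_(i < n) 2 ^+ i.+1 * (d <= 2^-1 ^+ i)%R%:R.
Proof.
move=> /andP[d0 d1]; elim: n => [|n IH] nd.
  by rewrite expr0 in nd; lra.
rewrite big_ord_recr /=.
have [nd'|dn] := ltP (2^-1 ^+ n) d.
  by rewrite (le_trans (IH nd'))// lerDl mulr_ge0// exprn_ge0.
rewrite -[leLHS]add0r lerD//.
  by apply: sumr_ge0 => i _; rewrite mulr_ge0// exprn_ge0.
by rewrite mulr1 -[leRHS]invrK lef_pV2 ?posrE// ?invr_gt0 ?exprn_gt0// -exprVn ltW.
Qed.

Lemma exists_half_expn_lt (R : realType) (d : R) : 0 < d -> exists n, 2^-1 ^+ n < d.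
Proof.
move=> d0; have d'0 : 0 <= d^-1 by rewrite invr_ge0 ltW.
exists (Num.truncn d^-1).+1; have /andP[_ h] := truncn_itv d'0.
rewrite exprVn -[ltRHS]invrK ltf_pV2 ?posrE ?invr_gt0 ?exprn_gt0//.
by apply: (lt_trans h); rewrite -natrX ltr_nat ltn_expl.
Qed.

(** On the level d <= 2^-i, the values [z q] and their gaps are at least a multiple of 2^(i/u), so
    [sum_gap_le] bounds that level by a multiple of 2^(-iv/u). The weight 2^(i+1) from
    [inv_le_dyadic_sum] leaves a geometric series, convergent because [u < v]. *)
Lemma sum_gap_inv_le (R : realType) (u v K : R) : 0 < u -> u < v -> 1 < v -> 0 < K ->
  exists2 C : R, 0 < C & forall (T : eqType) (l : seq T) (z : T -> int) (d : T -> R),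
  uniq l -> (forall q, q \in l -> 0 < d q <= 1) ->
  (forall q, q \in l -> z q != 0 /\ `|z q|%:~R `^ (- u) <= K * d q) ->
  (forall q q', q \in l -> q' \in l -> q != q' ->
     z q != z q' /\ `|z q - z q'|%:~R `^ (- u) <= K * (d q + d q')) ->
  \sum_(q <- l) `|z q|%:~R `^ (- v) * (d q)^-1 <= C.
Proof.
move=> u0 uv v1 K0; have v0 : 0 < v by lra.
have [C C0 CP] := sum_gap_le v1.
pose r : R := 2 * 2^-1 `^ (v / u).
have r01 : 0 <= r < 1.
  rewrite /r mulr_ge0 ?powR_ge0//=.
  rewrite -(powR_inv1 (ler0n R 2)) -powRrM mulN1r mul2_powRN_lt1//.
  by rewrite ltr_pdivlMr// mul1r.
have r1 : 0 < (1 - r)^-1 by rewrite invr_gt0 subr_gt0; case/andP: r01.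
pose D := C * ((2 * K) `^ (v / u) * 2 `^ v).
have D0 : 0 < D by rewrite mulr_gt0// mulr_gt0 ?powR_gt0// mulr_gt0.
exists (2 * D * (1 - r)^-1); first by rewrite mulr_gt0// mulr_gt0.
move=> T l z d ul d01 zu zzu.
have /choice[N NP] : forall q, exists n, q \in l -> 2^-1 ^+ n < d q.
  move=> q; have [ql|nql] := boolP (q \in l); last by exists 0%N.
  by have /andP[/exists_half_expn_lt[n nd] _] := d01 _ ql; exists n.
(* The number of levels depends on [l], but the geometric bound does not. *)
pose M := (\max_(q <- l) N q)%N.
have MP q : q \in l -> 2^-1 ^+ M < d q.
  move=> ql; apply: le_lt_trans (NP _ ql).
  rewrite ler_wiXn2l ?invr_ge0// ?invf_le1 ?ler1n//.
  by apply: leq_bigmax_seq.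
pose w q : R := `|z q|%:~R `^ (- v).
apply: (@le_trans _ _ (\sum_(q <- l) \sum_(i < M) w q * (2 ^+ i.+1 * (d q <= 2^-1 ^+ i)%R%:R))).
  rewrite big_seq [leRHS]big_seq; apply: ler_sum => q ql.
  rewrite -mulr_sumr; apply: ler_wpM2l; first exact: powR_ge0.
  by apply: inv_le_dyadic_sum; [exact: d01|exact: MP].
rewrite exchange_big /=.
apply: (@le_trans _ _ (\sum_(i < M) 2 * D * r ^+ i)); last first.
  rewrite -mulr_sumr; apply: ler_wpM2l; first by rewrite mulr_ge0 ?ltW.
  exact: sum_geometric_le.
apply: ler_sum => i _.
pose e : R := 2^-1 ^+ i; have e0 : 0 < e by rewrite exprn_gt0// invr_gt0.
have Ke0 : 0 < 2 * K * e by rewrite !mulr_gt0.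
(* [g] solves g^-u = 2Ke, the bound shared by single values and differences on this level. *)
pose g : R := (2 * K * e) `^ (- u^-1).
have g0 : 0 < g by exact: powR_gt0.
have gE (y : R) : 0 < y -> y `^ (- u) <= 2 * K * e -> g <= y.
  move=> y0 ye; have -> : y = (y `^ (- u)) `^ (- u^-1).
    by rewrite -powRrM mulrNN divff ?powRr1 ?(ltW y0)// gt_eqF.
  by apply: le_powRN => //; [rewrite invr_ge0 ltW|exact: powR_gt0].
pose li := [seq q <- l | d q <= e].
have liP q : q \in li -> (d q <= e) /\ (q \in l) by rewrite mem_filter => /andP[].
have int0 (m : int) : m != 0 -> 0 < `|m|%:~R :> R by rewrite ltr0z normr_gt0.
have := CP T li z g (filter_uniq _ ul) g0.
move=> /(_ _ _)/(le_trans _) sle.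
have -> : \sum_(q <- l) w q * (2 ^+ i.+1 * (d q <= e)%R%:R) = 2 ^+ i.+1 * \sum_(q <- li) w q.
  rewrite big_filter [in RHS]big_mkcond mulr_sumr; apply: eq_bigr => q _.
  by case: ifP => _; rewrite ?mulr1 ?mulr0 // mulrC.
have -> : 2 * D * r ^+ i = 2 ^+ i.+1 * (C * (g / 2) `^ (- v)).
  have h0 : 0 <= 2^-1 :> R by rewrite invr_ge0.
  have -> : (g / 2) `^ (- v) = (2 * K) `^ (v / u) * e `^ (v / u) * 2 `^ v.
    rewrite powRM ?(ltW g0)// -[in RHS]powRM ?mulr_ge0 ?(ltW e0) ?(ltW K0)//; congr (_ * _).
      by rewrite /g -powRrM mulrNN [u^-1 * v]mulrC.
    by rewrite -(powR_inv1 (ler0n R 2)) -powRrM mulrNN mul1r.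
  have -> : e `^ (v / u) = (2^-1 `^ (v / u)) ^+ i.
    by rewrite /e -(powR_mulrn i h0) -powRrM [i%:R * _]mulrC (powRrM _ (v / u)) powR_mulrn// powR_ge0.
  by rewrite /r exprMn exprS /D; ring.
rewrite ler_pM2l ?exprn_gt0//; apply: sle => //.
- move=> q /liP[de ql]; have [z0 zK] := zu _ ql; apply: gE; first exact: int0.
  apply: (le_trans zK); rewrite mulrAC; have : K * d q <= K * e by rewrite ler_pM2l.
  by have : 0 < K * e by [rewrite mulr_gt0]; lra.
- move=> q q' /liP[de ql] /liP[de' q'l] qq'; have [z0 zK] := zzu _ _ ql q'l qq'.
  apply: gE; first by apply: int0; rewrite subr_eq0.
  apply: (le_trans zK).
  by have -> : 2 * K * e = K * (e + e); [ring|rewrite ler_pM2l// lerD].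
Qed.

(** * Sup-norms and integer vectors *)

Lemma supnorm_ge0 (R : realType) (m k : nat) (M : 'M[R]_(m, k)) : 0 <= supnorm M.
Proof. exact: bigmax_ge_id. Qed.

Lemma le_entry_supnorm (R : realType) (m k : nat) (M : 'M[R]_(m, k)) i j :
  `|M i j| <= supnorm M.
Proof.
apply: le_trans (le_bigmax 0 (fun i => \big[Num.max/0]_j `|M i j|) i).
exact: (le_bigmax 0 (fun j => `|M i j|) j).
Qed.

Lemma supnorm_leP (R : realType) (m k : nat) (M : 'M[R]_(m, k)) (c : R) : 0 <= c ->
  (forall i j, `|M i j| <= c) -> supnorm M <= c.
Proof. by move=> c0 Mc; apply: bigmax_le => // i _; apply: bigmax_le. Qed.

Lemma supnormZ (R : realType) (m k : nat) (a : R) (M : 'M[R]_(m, k)) :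
  supnorm (a *: M) <= `|a| * supnorm M.
Proof.
apply: supnorm_leP => [|i j]; first by rewrite mulr_ge0// supnorm_ge0.
by rewrite mxE normrM ler_wpM2l// le_entry_supnorm.
Qed.

Lemma supnormB (R : realType) (m k : nat) (M N : 'M[R]_(m, k)) :
  supnorm (M - N) <= supnorm M + supnorm N.
Proof.
apply: supnorm_leP => [|i j]; first by rewrite addr_ge0// supnorm_ge0.
by rewrite !mxE; apply: le_trans (ler_normB _ _) _; rewrite lerD// le_entry_supnorm.
Qed.

Lemma supnorm_col_mx (R : realType) (m1 m2 k : nat)
    (M : 'M[R]_(m1, k)) (N : 'M[R]_(m2, k)) :
  supnorm (col_mx M N) = Num.max (supnorm M) (supnorm N).
Proof.
apply/eqP; rewrite eq_le ge_max; apply/and3P; split.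
- apply: supnorm_leP => [|i j]; first by rewrite le_max supnorm_ge0.
  rewrite le_max mxE; case: (fintype.split i) => l; by rewrite le_entry_supnorm ?orbT.
- apply: supnorm_leP => [|i j]; first exact: supnorm_ge0.
  by have := le_entry_supnorm (col_mx M N) (lshift m2 i) j; rewrite col_mxEu.
- apply: supnorm_leP => [|i j]; first exact: supnorm_ge0.
  by have := le_entry_supnorm (col_mx M N) (rshift m1 i) j; rewrite col_mxEd.
Qed.

Lemma supnorm11 (R : realType) (M : 'M[R]_1) : supnorm M = `|M ord0 ord0|.
Proof.
apply/eqP; rewrite eq_le le_entry_supnorm andbT.
by apply: supnorm_leP => // i j; rewrite !ord1.
Qed.

Lemma supnorm_col_attained (R : realType) (m : nat) (w : 'cV[R]_m) :
  0 < supnorm w -> exists i, `|w i ord0| = supnorm w.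
Proof.
move=> w0; apply: contrapT => H.
suff : supnorm w < supnorm w by rewrite ltxx.
rewrite [X in X < _]/supnorm; apply: bigmax_lt => // i _.
apply: bigmax_lt => // j _; rewrite ord1 lt_neqAle le_entry_supnorm andbT.
by apply/eqP => wi; apply: H; exists i.
Qed.

Lemma intmx_col_mx (R : realType) (m1 m2 k : nat)
    (M : 'M[int]_(m1, k)) (N : 'M[int]_(m2, k)) :
  intmx R (col_mx M N) = col_mx (intmx R M) (intmx R N).
Proof. exact: map_col_mx. Qed.

Lemma intmxB (R : realType) (m k : nat) (M N : 'M[int]_(m, k)) :
  intmx R (M - N) = intmx R M - intmx R N.
Proof. by apply/matrixP => i j; rewrite !mxE intrB. Qed.

Lemma intmxMn (R : realType) (m k n : nat) (M : 'M[int]_(m, k)) :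
  intmx R (M *+ n) = n%:R *: intmx R M.
Proof. by apply/matrixP => i j; rewrite !mxE mulmxnE rmorphMn mulr_natl. Qed.

Lemma supnorm_intmx_lt1 (R : realType) (m k : nat) (M : 'M[int]_(m, k)) :
  supnorm (intmx R M) < 1 -> M = 0.
Proof.
move=> M1; apply/matrixP => i j; rewrite [RHS]mxE.
have := le_lt_trans (le_entry_supnorm (intmx R M) i j) M1.
by rewrite mxE -intr_norm -[ltRHS]/(1%:~R) ltr_int; lia.
Qed.

Lemma supnorm_intmx_ge1 (R : realType) (m k : nat) (M : 'M[int]_(m, k)) :
  M != 0 -> 1 <= supnorm (intmx R M).
Proof. by apply: contraR; rewrite -ltNge => /supnorm_intmx_lt1 ->. Qed.

Lemma finite_supnorm_le (R : realType) (k : nat) (Q : R) :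
  finite_set [set q : 'cV[int]_k | supnorm (intmx R q) <= Q].
Proof.
pose N := (Num.truncn Q).+1.
pose f (g : {ffun 'I_k -> 'I_(N + N)}) : 'cV[int]_k := \col_i ((g i)%:Z - N%:Z).
apply: (@sub_finite_set _ _ (f @` setT)); last first.
  exact: finite_image.
move=> q /= qQ.
have Q0 : 0 <= Q by apply: le_trans (supnorm_ge0 _) qQ.
have /andP[_ QN] := truncn_itv Q0.
have qN i : `|q i ord0| < N.
  rewrite -(ltr_int R) intr_norm; apply: le_lt_trans QN; apply: le_trans qQ.
  by have := le_entry_supnorm (intmx R q) i ord0; rewrite mxE.
have /choice[g gP] : forall i, exists j : 'I_(N + N), (j%:Z - N%:Z) = q i ord0.
  move=> i; have := qN i => qi.
  have jN : (absz (q i ord0 + N%:Z)%R < N + N)%N by lia.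
  by exists (Ordinal jN) => /=; lia.
exists (finfun g) => //; apply/colP => i; rewrite mxE ffunE; exact: gP.
Qed.

(** Lets a gain in the exponent swallow a constant factor once [y] is large. *)
Lemma powRN_absorb (R : realType) (K e : R) : 0 < K -> 0 < e ->
  exists2 Q : R, 1 <= Q & forall y, Q < y -> K * y `^ (- e) < 1.
Proof.
move=> K0 e0; exists (Num.max 1 (K `^ e^-1)); first by rewrite le_max lexx.
move=> y; rewrite gt_max => /andP[y1 yK].
have y0 : 0 < y by lra.
rewrite powRN ltr_pdivrMr ?powR_gt0// mul1r.
have -> : K = (K `^ e^-1) `^ e by rewrite -powRrM mulVf ?gt_eqF// powRr1// ltW.
by apply: gt0_ltr_powR; rewrite ?nnegrE ?powR_ge0// ltW.
Qed.

(** The norm dominates every entry, so its power -v is at most the product over the entries of their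
    powers -a, with [a = v / n.+1 > 1] and everything cut off at 1. The sum of such products is a
    product of one-dimensional sums. *)
Lemma sum_cV_powRN_le (R : realType) (n : nat) (v : R) : n.+1%:R < v ->
  exists2 C : R, 0 < C & forall l : seq 'cV[int]_n.+1, uniq l ->
  \sum_(q <- l) (Num.max 1 (supnorm (intmx R q))) `^ (- v) <= C.
Proof.
move=> nv; pose a := v / n.+1%:R.
have n0 : 0 < n.+1%:R :> R by rewrite ltr0n.
have a1 : 1 < a by rewrite ltr_pdivlMr// mul1r.
have [C C0 CP] := sum_int_powRN_le a1.
exists (C ^+ n.+1) => [|l ul]; first exact: exprn_gt0.
pose h (k : int) : R := (Num.max 1 `|k|%:~R) `^ (- a).
have hq (q : 'cV[int]_n.+1) :
    (Num.max 1 (supnorm (intmx R q))) `^ (- v) <= \prod_i h (q i ord0).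
  pose S := Num.max 1 (supnorm (intmx R q)).
  have S0 : 0 < S by rewrite lt_max ltr01.
  apply: (@le_trans _ _ (\prod_(i < n.+1) S `^ (- a))).
    rewrite prodr_const card_ord -powR_mulrn ?powR_ge0// -powRrM.
    by rewrite mulNr divfK// gt_eqF.
  apply: ler_prod => i _; rewrite powR_ge0 /=; apply: le_powRN; first by lra.
    by rewrite lt_max ltr01.
  rewrite /S ge_max !le_max lexx /= orbC intr_norm.
  by have := le_entry_supnorm (intmx R q) i ord0; rewrite mxE => ->.
apply: le_trans (ler_sum _ (fun q _ => hq q)) _.
(* Enlarging [l] to all vectors with entries in [L] makes the sum factor. *)
pose L := undup (flatten [seq [seq q i ord0 | i <- enum 'I_n.+1] | q : 'cV[int]_n.+1 <- l]).
pose f (g : {ffun 'I_n.+1 -> seq_sub L}) : 'cV[int]_n.+1 := \col_i ssval (g i).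
apply: (@le_trans _ _ (\sum_(q <- [seq f g | g : {ffun 'I_n.+1 -> seq_sub L}]) \prod_i h (q i ord0))).
  apply: ler_sum_uniq_sub => // [q ql|q]; last by apply: prodr_ge0 => i _; exact: powR_ge0.
  have qL i : q i ord0 \in L.
    rewrite mem_undup; apply/flattenP; exists [seq q i ord0 | i <- enum 'I_n.+1].
      by apply/mapP; exists q.
    by apply/mapP; exists i => //; rewrite mem_enum.
  apply/mapP; exists [ffun i => SeqSub (qL i)]; first by rewrite mem_enum.
  by apply/colP => i; rewrite mxE ffunE.
rewrite big_map big_enum /=.
under eq_bigr do under eq_bigr do rewrite mxE.
rewrite -(bigA_distr_bigA (fun _ (j : seq_sub L) => h (ssval j))) /=.
rewrite prodr_const card_ord; apply: lerXn2r.
- by rewrite nnegrE sumr_ge0// => i _; exact: powR_ge0.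
- by rewrite nnegrE ltW.
apply: le_trans (CP _ (undup_uniq _ : uniq L)).
rewrite -(big_map (@ssval _ L) xpredT h); apply: ler_sum_uniq_sub.
- by rewrite map_inj_uniq ?index_enum_uniq//; exact: val_inj.
- by move=> k /mapP[j _ ->]; exact: ssvalP.
- by move=> k; exact: powR_ge0.
Qed.

(* If [A q + p] could be made arbitrarily small for one nonzero [q], all
   multiples of [q] would be solutions. *)
Lemma W_plus_lower_bound (R : realType) (m k : nat) (v u : R) (A : 'M[R]_(m, k)) :
  ~ W_plus v A -> v < u -> 0 < u ->
  exists2 c : R, 0 < c & forall q : 'cV[int]_k, q != 0 ->
  forall p : 'cV[int]_m, c * supnorm (intmx R q) `^ (- u) <= supnorm (A *m intmx R q + intmx R p).
Proof.
move=> nW vu u0.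
pose F := [set q : 'cV[int]_k | exists p : 'cV[int]_m,
  supnorm (A *m intmx R q + intmx R p) <= supnorm (intmx R q) `^ (- u)].
have finF : finite_set F by apply: contrapT => WF; apply: nW; exists u.
have step (q : 'cV[int]_k) : q != 0 -> exists2 c : R, 0 < c &
    forall p : 'cV[int]_m, c <= supnorm (A *m intmx R q + intmx R p).
  move=> q0; apply: contrapT => H.
  have qF (j : nat) : F (q *+ j.+1).
    (* Small enough that [j.+1] times the error stays below the bound required of [q *+ j.+1]. *)
    pose e := supnorm (intmx R (q *+ j.+1)) `^ (- u) / j.+1%:R.
    have j0 : 0 < j.+1%:R :> R by rewrite ltr0n.
    have qj0 : q *+ j.+1 != 0.
      apply: contraNneq q0 => /matrixP qj; apply/eqP/matrixP => i l.
      have := qj i l; rewrite mulmxnE !mxE => /eqP.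
      by rewrite mulrn_eq0 /= => /eqP.
    have e0 : 0 < e.
      rewrite divr_gt0// powR_gt0//; apply: lt_le_trans ltr01 _.
      exact: supnorm_intmx_ge1.
    have [p pe] : exists p : 'cV[int]_m, supnorm (A *m intmx R q + intmx R p) < e.
      apply: contrapT => Hp; apply: H; exists e => // p.
      by rewrite leNgt; apply/negP => pe; apply: Hp; exists p.
    exists (p *+ j.+1).
    rewrite !intmxMn -scalemxAr -scalerDr.
    apply: le_trans (supnormZ _ _) _.
    by rewrite ger0_norm ?ler0n// mulrC -ler_pdivlMr// -intmxMn ltW.
  (* The multiples of a nonzero [q] are distinct, so [F] would be infinite. *)
  have : finite_set ((fun j : nat => q *+ j.+1) @^-1` F).
    apply: finite_preimage finF => i j _ _ qij.
    have [r [l qrl]] : exists r l, q r l != 0.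
      apply: contrapT => Hq; case/eqP: q0; apply/matrixP => r l; rewrite mxE.
      by apply/eqP/negPn/negP => qrl; apply: Hq; exists r, l.
    have := congr1 (fun M : 'cV[int]_k => M r l) qij.
    rewrite !mulmxnE -[LHS]mulr_natr -[RHS]mulr_natr => /(mulfI qrl)/eqP.
    by rewrite eqr_nat => /eqP [].
  have -> : (fun j : nat => q *+ j.+1) @^-1` F = setT.
    by apply/seteqP; split=> // j _; exact: qF.
  exact: infinite_nat.
have /finite_seqP[s Fs] := finF.
(* The finitely many elements of [F] get a common constant; outside [F] the constant 1 works. *)
have [c c0 cP] : exists2 c : R, 0 < c & forall q, q \in s -> q != 0 ->
    forall p : 'cV[int]_m, c <= supnorm (A *m intmx R q + intmx R p).
  elim: s {Fs} => [|q s [c c0 IH]]; first by exists 1.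
  have [q0|/step[c' c'0 H]] := eqVneq q 0.
    exists c => // q'; rewrite inE => /orP[/eqP ->|]; last exact: IH.
    by rewrite q0 eqxx.
  exists (Num.min c c'); first by rewrite lt_min c0.
  move=> q'; rewrite inE => /orP[/eqP -> _ p|qs q'0 p]; first by rewrite ge_min H orbT.
  by rewrite ge_min IH.
exists (Num.min c 1); first by rewrite lt_min c0 ltr01.
move=> q q0 p.
have q1 := supnorm_intmx_ge1 R q0.
have qu0 := powR_ge0 (supnorm (intmx R q)) (- u).
have qu1 : supnorm (intmx R q) `^ (- u) <= 1.
  by rewrite -[leRHS](powRr0 (supnorm (intmx R q))) ler_powR// oppr_le0 ltW.
have [qs|qs] := boolP (q \in s).
  apply: le_trans (cP _ qs q0 p); rewrite -[leRHS]mulr1.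
  by apply: ler_pM => //; [rewrite le_min (ltW c0) ler01|rewrite ge_min lexx].
apply: (@le_trans _ _ (supnorm (intmx R q) `^ (- u))).
  by apply: ler_piMl => //; rewrite ge_min lexx orbT.
rewrite leNgt; apply/negP => /ltW qp; move/negP: qs; apply.
by have : F q by [exists p]; rewrite Fs.
Qed.

(** * The affine forms *)

(** [form_cst] and [form_lin] are the parts c(q) and w(q) of the affine form: the upper [s] entries
    of [q] multiply [x] itself, the lower [t] entries go through [A]. *)
Definition form_cst (R : realType) (s t : nat) (A : 'M[R]_(1 + s, t))
    (q : 'cV[int]_(s + t)) : R := (usubmx A *m intmx R (dsubmx q)) ord0 ord0.

Definition form_lin (R : realType) (s t : nat) (A : 'M[R]_(1 + s, t))
    (q : 'cV[int]_(s + t)) : 'cV[R]_s :=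
  intmx R (usubmx q) + dsubmx A *m intmx R (dsubmx q).

Lemma affine_map_formE (R : realType) (s t : nat) (A : 'M[R]_(1 + s, t))
    (x : 'rV[R]_s) (q : 'cV[int]_(s + t)) (p : 'cV[int]_1) :
  (affine_map A x *m intmx R q + intmx R p) ord0 ord0 =
  (p ord0 ord0)%:~R + form_cst A q + \sum_j x ord0 j * form_lin A q j ord0.
Proof.
have -> : \sum_j x ord0 j * form_lin A q j ord0 = (x *m form_lin A q) ord0 ord0.
  by rewrite mxE.
rewrite -{1}(vsubmxK q) intmx_col_mx /affine_map mul_row_col -mulmxA.
rewrite -{1}(vsubmxK A) mul_col_mx mul_row_col mul1mx.
rewrite /form_lin mulmxDr /form_cst !mxE; ring.
Qed.

(** The bridge between the two approximation problems: for [A], the lower part of [q] is the integer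
    vector, while its upper part joins [p] in the translation. *)
Lemma supnorm_formE (R : realType) (s t : nat) (A : 'M[R]_(1 + s, t))
    (q : 'cV[int]_(s + t)) (p : 'cV[int]_1) :
  supnorm (A *m intmx R (dsubmx q) + intmx R (col_mx p (usubmx q))) =
  Num.max `|(p ord0 ord0)%:~R + form_cst A q| (supnorm (form_lin A q)).
Proof.
rewrite -{1}(vsubmxK A) mul_col_mx intmx_col_mx add_col_mx supnorm_col_mx.
rewrite supnorm11 /form_lin [X in supnorm X]addrC; congr (Num.max `|_| _).
by rewrite /form_cst !mxE addrC.
Qed.

Lemma dot_le (R : realType) (s : nat) (B : R) (x : 'rV[R]_s) (w : 'cV[R]_s) :
  (forall j, `|x ord0 j| <= B) ->
  `|\sum_j x ord0 j * w j ord0| <= s%:R * B * supnorm w.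
Proof.
move=> xB; apply: le_trans (ler_norm_sum _ _ _) _.
apply: (@le_trans _ _ (\sum_(j < s) B * supnorm w)).
  by apply: ler_sum => j _; rewrite normrM ler_pM// le_entry_supnorm.
by rewrite sumr_const card_ord -mulrA mulr_natl.
Qed.

Lemma supnorm_mulmx (R : realType) (m k l : nat) (A : 'M[R]_(m, k)) (M : 'M[R]_(k, l)) :
  supnorm (A *m M) <= k%:R * supnorm A * supnorm M.
Proof.
apply: supnorm_leP => [|i j]; first by rewrite !mulr_ge0 ?supnorm_ge0.
rewrite mxE; apply: le_trans (ler_norm_sum _ _ _) _.
apply: (@le_trans _ _ (\sum_(j < k) supnorm A * supnorm M)).
  by apply: ler_sum => r _; rewrite normrM ler_pM// le_entry_supnorm.
by rewrite sumr_const card_ord -mulrA mulr_natl.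
Qed.

(** A solution [q] for [A] with translation [p] gives the vector (p', q), where p' is the lower part
    of [p] and the top entry of [p] is the new translation. The constants lost are absorbed by
    lowering [u] to [v]. *)
Lemma W_plus_VWA (R : realType) (s t : nat) (A : 'M[R]_(1 + s, t)) (x : 'rV[R]_s) :
  W_plus (s + t)%:R A -> VWA (affine_map A x).
Proof.
move=> [u [nu Wu]]; pose n : R := (s + t)%:R.
have n0 : 0 <= n by rewrite ler0n.
pose v := (n + u) / 2.
have nv : n < v by rewrite /v /n; lra.
have vu : 0 < u - v by rewrite /v /n; lra.
exists v; split=> // fin.
(* [C1] is the cost of evaluating the form at [x], and [E] bounds the norm of (p', q) relative to
   that of [q]. *)
pose C1 : R := 1 + s%:R * supnorm x.
have C1_gt0 : 0 < C1 by have := supnorm_ge0 x; have := ler0n R s; rewrite /C1; nra.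
pose E : R := 2 + t%:R * supnorm A.
have E_gt0 : 0 < E by have := supnorm_ge0 A; have := ler0n R t; rewrite /E; nra.
have [Q Q1 QP] := @powRN_absorb R (C1 * E `^ v) (u - v) (mulr_gt0 C1_gt0 (powR_gt0 _ E_gt0)) vu.
have inf := infinite_setD Wu (@finite_supnorm_le R t Q).
have /choice[p pP] : forall q : 'cV[int]_t, exists p : 'cV[int]_(1 + s),
   supnorm (intmx R q) > Q -> (exists p : 'cV[int]_(1 + s),
     supnorm (A *m intmx R q + intmx R p) <= supnorm (intmx R q) `^ (- u)) ->
   supnorm (A *m intmx R q + intmx R p) <= supnorm (intmx R q) `^ (- u).
  move=> q; have [[p pq]|H] := pselect (exists p : 'cV[int]_(1 + s),
     supnorm (A *m intmx R q + intmx R p) <= supnorm (intmx R q) `^ (- u)).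
    by exists p.
  by exists 0.
apply: inf.
(* [q] is the lower part of the new vector, so distinct [q] give distinct vectors. *)
have fin' := @finite_preimage _ _ _ (fun q => col_mx (dsubmx (p q)) q)
  (fun q q' _ _ h => (eq_col_mx h).2) fin.
apply: sub_finite_set fin' => q [/= qW /negP].
rewrite -ltNge => Qq.
have pq := pP q Qq qW.
set N := supnorm (intmx R q) in Qq pq.
have N1 : 1 < N by lra.
have N0 : 0 < N by lra.
exists (usubmx (p q)).
set Q' := col_mx _ _.
have dQ : dsubmx Q' = q by rewrite col_mxKd.
have uQ : usubmx Q' = dsubmx (p q) by rewrite col_mxKu.
have W := supnorm_formE A Q' (usubmx (p q)).
rewrite dQ uQ vsubmxK in W; rewrite W in pq.
move: pq; rewrite ge_max => /andP[pq1 pq2].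
have Nu1 : N `^ (- u) <= 1.
  by rewrite -[leRHS](powRr0 N) ler_powR// ?ltW//; lra.
have NQ' : N <= supnorm (intmx R Q').
  by rewrite intmx_col_mx supnorm_col_mx le_max lexx orbT.
have Q'E : supnorm (intmx R Q') <= E * N.
  rewrite intmx_col_mx supnorm_col_mx ge_max -/N; apply/andP; split; last first.
    have := supnorm_ge0 A; have := ler0n R t => t0 A0.
    have : 0 <= t%:R * supnorm A by rewrite mulr_ge0.
    by rewrite /E; nra.
  have -> : intmx R (dsubmx (p q)) = form_lin A Q' - dsubmx A *m intmx R q.
    by rewrite /form_lin dQ uQ addrK.
  apply: le_trans (supnormB _ _) _.
  have h1 := supnorm_mulmx (dsubmx A) (intmx R q).
  have h2 : supnorm (dsubmx A) <= supnorm A.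
    apply: supnorm_leP => [|i j]; first exact: supnorm_ge0.
    by rewrite mxE le_entry_supnorm.
  have h3 : t%:R * supnorm (dsubmx A) * N <= t%:R * supnorm A * N.
    by rewrite ler_wpM2r ?(ltW N0)// ler_wpM2l.
  by rewrite -/N in h1; rewrite /E; lra.
rewrite supnorm11 affine_map_formE.
apply: le_trans (_ : (E * N) `^ (- v) <= _); last first.
  by apply: le_powRN => //; [rewrite /v /n; lra|lra].
apply: (@le_trans _ _ (C1 * N `^ (- u))).
  apply: le_trans (ler_normD _ _) _.
  have := @dot_le R s (supnorm x) x (form_lin A Q') (fun j => le_entry_supnorm x ord0 j).
  have : s%:R * supnorm x * supnorm (form_lin A Q') <= s%:R * supnorm x * N `^ (- u).
    by rewrite ler_wpM2l// mulr_ge0 ?supnorm_ge0.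
  by rewrite /C1; lra.
have := QP _ Qq.
have -> : (E * N) `^ (- v) = (E `^ v)^-1 * N `^ (- v).
  by rewrite powRM ?ltW// powRN.
have -> : N `^ (- u) = N `^ (- v) * N `^ (- (u - v)).
  have {1}-> : - u = - v + - (u - v) by ring.
  by rewrite powRD// (gt_eqF N0) implybT.
have Nv0 : 0 < N `^ (- v) by rewrite powR_gt0.
have Ev0 : 0 < E `^ v by rewrite powR_gt0.
move=> /ltW h.
rewrite mulrCA [leRHS]mulrC ler_pM2l// -div1r ler_pdivlMr//.
by rewrite mulrAC.
Qed.

(** Only these [q] enter the Borel-Cantelli sum: the slabs of other large [q] miss [X], and the
    finitely many [q] of norm at most [Q] do not affect lying in infinitely many slabs. *)
Definition resonant (R : realType) (s t : nat) (A : 'M[R]_(1 + s, t))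
    (X : set 'rV[R]_s) (v Q : R) (q : 'cV[int]_(s + t)) : Prop :=
  Q < supnorm (intmx R q) /\ exists x, X x /\ exists p : int,
  `|p%:~R + form_cst A q + \sum_j x ord0 j * form_lin A q j ord0|
    <= supnorm (intmx R q) `^ (- v).

(** By [covered_near_int] the slabs of [q] cost a multiple of |q|^-v (1 + 1/|w(q)|). The first term
    is summed by [sum_cV_powRN_le], the second by hypothesis. *)
Lemma null_of_summable (R : realType) (s t : nat) (A : 'M[R]_(1 + s.+1, t))
    (X : set 'rV[R]_s.+1) (B v Q C : R) :
  0 < B -> (forall x, X x -> forall j, `|x ord0 j| <= B) ->
  (s.+1 + t)%:R < v -> 1 <= Q ->
  (forall q, resonant A X v Q q -> 0 < supnorm (form_lin A q)) ->
  (forall l : seq 'cV[int]_(s.+1 + t), uniq l -> (forall q, q \in l -> resonant A X v Q q) ->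
     \sum_(q <- l) supnorm (intmx R q) `^ (- v) * (supnorm (form_lin A q))^-1 <= C) ->
  lebesgue_null [set x | X x /\ W_set v (affine_map A x)].
Proof.
move=> B0 XB nv Q1 lin0 lC.
have v0 : 0 < v by apply: le_lt_trans nv; rewrite ler0n.
have [C1 C10 C1P] := covered_near_int s B0.
have [C2 C20 C2P] := @sum_cV_powRN_le R (s + t) v nv.
pose E q := [set x | Q < supnorm (intmx R q) /\ X x /\ exists p : int,
  `|p%:~R + form_cst A q + \sum_j x ord0 j * form_lin A q j ord0|
    <= supnorm (intmx R q) `^ (- v)].
pose del (q : 'cV[int]_(s.+1 + t)) := supnorm (intmx R q) `^ (- v).
(* If [q] is not resonant, [E q] is empty and costs nothing, even when w(q) vanishes. *)
pose c q := if `[< resonant A X v Q q >] then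
  C1 * (del q * (1 + (supnorm (form_lin A q))^-1)) else 0.
have Ec q : covered (E q) (c q).
  rewrite /c; case: asboolP => [gq|ngq].
    have [i wi] := supnorm_col_attained (lin0 _ gq).
    have [Qq _] := gq.
    have del01 : 0 < del q <= 1.
      rewrite powR_gt0 /=; last by lra.
      rewrite /del -[leRHS](powRr0 (supnorm (intmx R q))) ler_powR//; last by lra.
      by rewrite ltW// (le_lt_trans Q1).
    apply: coveredS (C1P (form_cst A q) _ _ _ _ del01 (lin0 _ gq) wi _).
      by move=> x [_ [Xx xp]]; split=> //; exact: XB.
    by move=> j; exact: le_entry_supnorm.
  apply: coveredS (covered_set0 R s) => x [Qq [Xx xp]]; apply: ngq.
  by split=> //; exists x.
have := @borel_cantelli R s _ E c (C1 * (C2 + C)) Ec.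
move=> /(_ _)/null_sub; apply.
  move=> x [Xx Wx] /= fin; apply: (infinite_setD Wx (@finite_supnorm_le R (s.+1 + t) Q)).
  apply: sub_finite_set fin => q [[p pq]] /= /negP; rewrite -ltNge => Qq.
  by split=> //; split=> //; exists (p ord0 ord0); rewrite -affine_map_formE -supnorm11.
move=> l ul.
pose l' := [seq q <- l | `[< resonant A X v Q q >]].
have -> : \sum_(q <- l) c q =
    C1 * (\sum_(q <- l') del q + \sum_(q <- l') del q * (supnorm (form_lin A q))^-1).
  rewrite -big_split mulr_sumr big_filter [RHS]big_mkcond; apply: eq_bigr => q _.
  by rewrite /c; case: ifP => //; rewrite mulrDr mulr1.
have ul' : uniq l' by rewrite filter_uniq.
rewrite ler_pM2l// lerD//; last first.
  by apply: lC => // q; rewrite mem_filter => /andP[/asboolP].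
apply: le_trans (C2P _ ul'); rewrite big_seq [leRHS]big_seq; apply: ler_sum => q.
rewrite mem_filter => /andP[/asboolP[Qq _] _]; rewrite max_r//.
exact: ltW (le_lt_trans Q1 Qq).
Qed.

(** * The two cases *)

(** The upper parts differ by [form_lin A q - form_lin A q'], which is then an integer vector of
    norm less than 1. *)
Lemma form_lin_eq (R : realType) (s t : nat) (A : 'M[R]_(1 + s, t))
    (q q' : 'cV[int]_(s + t)) :
  dsubmx q = dsubmx q' -> supnorm (form_lin A q) + supnorm (form_lin A q') < 1 -> q = q'.
Proof.
move=> dq w1; rewrite -(vsubmxK q) -(vsubmxK q') dq; congr col_mx.
apply/eqP; rewrite -subr_eq0; apply/eqP/(@supnorm_intmx_lt1 R).
apply: le_lt_trans w1; rewrite intmxB.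
have -> : intmx R (usubmx q) - intmx R (usubmx q') = form_lin A q - form_lin A q'.
  by rewrite /form_lin dq opprD addrACA subrr addr0.
exact: supnormB.
Qed.

(** Otherwise [form_lin_eq], applied to [q] and the zero vector, would give [q = 0]. *)
Lemma form_lin_dsubmx_neq0 (R : realType) (s t : nat) (A : 'M[R]_(1 + s, t))
    (q : 'cV[int]_(s + t)) :
  0 < supnorm (intmx R q) -> supnorm (form_lin A q) < 1 -> dsubmx q != 0.
Proof.
move=> q0 w1; apply/eqP => dq.
have form0 : form_lin A 0 = 0.
  by rewrite /form_lin !linear0 /intmx !map_mx0 mulmx0 addr0.
have sup0 m k : supnorm (0 : 'M[R]_(m, k)) = 0.
  by apply/eqP; rewrite eq_le supnorm_ge0 supnorm_leP// => i j; rewrite mxE normr0.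
have : q = 0.
  by apply: (@form_lin_eq R s t A); rewrite ?dq ?linear0// form0 sup0 addr0.
by move=> q00; move: q0; rewrite q00 /intmx map_mx0 sup0 ltxx.
Qed.

Lemma supnorm_dsubmx_le (R : realType) (s t : nat) (q : 'cV[int]_(s + t)) :
  supnorm (intmx R (dsubmx q)) <= supnorm (intmx R q).
Proof. by rewrite -{2}(vsubmxK q) intmx_col_mx supnorm_col_mx le_max lexx orbT. Qed.

(** Trades part of the exponent for a power of the smaller [x], keeping y^-(v-u) to absorb
    constants. *)
Lemma powRN_split (R : realType) (u v x y : R) : 0 < u -> 0 < x -> x <= y ->
  y `^ (- v) <= y `^ (- (v - u)) * x `^ (- u).
Proof.
move=> u0 x0 xy; have y0 := lt_le_trans x0 xy.
have {1}-> : - v = - (v - u) + - u by ring.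
rewrite powRD ?(gt_eqF y0) ?implybT// ler_wpM2l ?powR_ge0//.
by apply: le_powRN => //; exact: ltW.
Qed.

(** Where |w(q)| >= 1/2, the sum of |q|^-v suffices. Elsewhere the lower bound for [A], applied to
    [q] and to differences [q - q'], yields the hypotheses of [sum_gap_inv_le]. *)
Lemma null_hyperplane_case (R : realType) (s : nat) (A : 'M[R]_(1 + s.+1, 1)) (B v : R) :
  0 < B -> (s.+1 + 1)%:R < v -> ~ W_plus (s.+1 + 1)%:R A ->
  lebesgue_null [set x : 'rV[R]_s.+1 | (forall j, `|x ord0 j| <= B) /\ W_set v (affine_map A x)].
Proof.
move=> B0 nv nW.
pose n : R := (s.+1 + 1)%:R; pose u := (n + v) / 2.
have n1 : 1 <= n by rewrite ler1n addn1.
have nu : n < u by rewrite /u /n; lra.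
have uv : 0 < v - u by rewrite /u /n; lra.
have uv' : u < v by lra.
have u0 : 0 < u by lra.
have v1 : 1 < v by lra.
have [c c0 cP] := W_plus_lower_bound nW nu u0.
pose F := s.+1%:R * B + 1.
have sB0 : 0 < s.+1%:R * B by rewrite mulr_gt0.
have F0 : 0 < F by rewrite /F; lra.
(* Beyond [Q], the slab width |q|^-v is at most half of the lower bound c |z|^-u. *)
have [Q Q1 QP] := @powRN_absorb R (2 / c) (v - u) (divr_gt0 (ltr0n R 2) c0) uv.
pose X := [set x : 'rV[R]_s.+1 | forall j, `|x ord0 j| <= B].
have K0 : 0 < 2 * F / c by rewrite divr_gt0// mulr_gt0.
have [C1 C10 C1P] := sum_gap_inv_le u0 uv' v1 K0.
have [C2 C20 C2P] := @sum_cV_powRN_le R (s + 1) v nv.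
pose z (q : 'cV[int]_(s.+1 + 1)) : int := dsubmx q ord0 ord0.
have zE q : supnorm (intmx R (dsubmx q)) = `|z q|%:~R.
  by rewrite supnorm11 mxE intr_norm.
pose w q := supnorm (form_lin A q).
have res q : resonant A X v Q q -> w q < 2^-1 ->
  [/\ z q != 0, supnorm (intmx R q) `^ (- v) <= `|z q|%:~R `^ (- v),
      `|z q|%:~R `^ (- u) <= 2 * F / c * w q &
      exists p : 'cV[int]_1, supnorm (A *m intmx R (dsubmx q) + intmx R (col_mx p (usubmx q)))
        <= 2 * F * w q].
  move=> [Qq [x [xB [p pq]]]] wq.
  have q0 : 0 < supnorm (intmx R q) by lra.
  have dq0 : dsubmx q != 0 by apply: (form_lin_dsubmx_neq0 q0 (A := A)); rewrite -/(w q); lra.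
  have z0 : z q != 0.
    by apply: contraNneq dq0 => zq0; apply/eqP/matrixP => i j; rewrite !ord1 [RHS]mxE.
  have zq : `|z q|%:~R <= supnorm (intmx R q) by rewrite -zE supnorm_dsubmx_le.
  have zR0 : 0 < `|z q|%:~R :> R by rewrite ltr0z normr_gt0.
  have small : supnorm (intmx R q) `^ (- v) <= c / 2 * `|z q|%:~R `^ (- u).
    apply: le_trans (powRN_split v u0 zR0 zq) _; apply: ler_wpM2r; first exact: powR_ge0.
    have /ltW := QP _ Qq; rewrite mulrC mulrA ler_pdivrMr// mul1r; lra.
  pose P : 'cV[int]_1 := const_mx p.
  have supE := supnorm_formE A q P; rewrite mxE -/(w q) in supE.
  have supP : supnorm (A *m intmx R (dsubmx q) + intmx R (col_mx P (usubmx q)))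
      <= supnorm (intmx R q) `^ (- v) + F * w q.
    have w0 : 0 <= w q := supnorm_ge0 _.
    have d0 := powR_ge0 (supnorm (intmx R q)) (- v).
    have sB : 0 <= s.+1%:R * B * w q by rewrite !mulr_ge0// ltW.
    rewrite supE ge_max /F; apply/andP; split; last by lra.
    have := dot_le (form_lin A q) xB; rewrite -/(w q).
    by move: pq; rewrite !ler_norml; lra.
  have := cP _ dq0 (col_mx P (usubmx q)); rewrite zE => low.
  (* The width accounts for at most half of the lower bound, so [F * w q] supplies the other
     half. *)
  have Fw : c * `|z q|%:~R `^ (- u) <= 2 * F * w q by lra.
  split=> //.
  - by apply: le_powRN => //; lra.
  - by rewrite mulrAC ler_pdivlMr// mulrC.
  - by exists P; lra.
apply: (null_of_summable (C := C1 + 2 * C2) B0 _ nv Q1) => // [q rq|l ul lr].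
  rewrite -/(w q); have [wq|] := ltP (w q) 2^-1; last by apply: lt_le_trans; rewrite invr_gt0.
  have [z0 _ zw _] := res q rq wq.
  have : 0 < 2 * F / c * w q.
    by apply: lt_le_trans zw; rewrite powR_gt0// ltr0z normr_gt0.
  by rewrite pmulr_rgt0.
rewrite (bigID (fun q => w q < 2^-1)) /= -/(w _); apply: lerD.
  rewrite -big_filter; pose l1 := [seq q <- l | w q < 2^-1].
  have l1P q : q \in l1 -> w q < 2^-1 /\ resonant A X v Q q.
    by rewrite mem_filter => /andP[wq ql]; split=> //; exact: lr.
  apply: (@le_trans _ _ (\sum_(q <- l1) `|z q|%:~R `^ (- v) * (w q)^-1)).
    rewrite big_seq [leRHS]big_seq; apply: ler_sum => q /l1P[wq rq].
    have [_ zv _ _] := res q rq wq.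
    by rewrite ler_wpM2r// invr_ge0 supnorm_ge0.
  apply: C1P; first by rewrite filter_uniq.
  - move=> q /l1P[wq rq]; have [z0 _ zw _] := res q rq wq.
    have : 0 < 2 * F / c * w q.
      by apply: lt_le_trans zw; rewrite powR_gt0// ltr0z normr_gt0.
    by rewrite pmulr_rgt0// => -> /=; lra.
  - by move=> q /l1P[wq rq]; have [z0 _ zw _] := res q rq wq.
  move=> q q' /l1P[wq rq] /l1P[wq' rq'] qq'.
  have [_ _ _ [p pq]] := res q rq wq; have [_ _ _ [p' pq']] := res q' rq' wq'.
  (* Both [w q] and [w q'] are below 1/2, so equal last coordinates would force [q = q']. *)
  have dd : dsubmx q - dsubmx q' != 0.
    rewrite subr_eq0; apply: contra_neq qq' => dd.
    by apply: (form_lin_eq (A := A) dd); rewrite -!/(w _); lra.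
  have zz : z q - z q' = (dsubmx q - dsubmx q') ord0 ord0 by rewrite [RHS]mxE [X in _ = _ + X]mxE.
  split.
    apply: contraNneq dd => zqq'; apply/eqP/matrixP => i j.
    by rewrite !ord1 -zz zqq' subrr mxE.
  (* Subtracting the two near-solutions for [A] turns the lower bound into a gap between values of
     [z]. *)
  have := cP _ dd (col_mx p (usubmx q) - col_mx p' (usubmx q')).
  rewrite !intmxB mulmxBr -addrACA -opprD -intmxB supnorm11 mxE -intr_norm -zz.
  move=> /le_trans /(_ (supnormB _ _)) low.
  rewrite mulrAC ler_pdivlMr// mulrC; lra.
apply: (@le_trans _ _ (\sum_(q <- l) 2 * (Num.max 1 (supnorm (intmx R q))) `^ (- v))); last first.
  by rewrite -mulr_sumr ler_pM2l// C2P.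
rewrite big_mkcond big_seq [leRHS]big_seq; apply: ler_sum => q ql.
case: ifPn => [|_]; last by rewrite mulr_ge0 ?powR_ge0.
rewrite -leNgt => wq; have [Qq _] := lr _ ql.
rewrite max_r; last by lra.
rewrite mulrC; apply: ler_wpM2r; first exact: powR_ge0.
by rewrite -[leRHS]invrK lef_pV2// posrE ?invr_gt0//; apply: lt_le_trans wq; rewrite invr_gt0.
Qed.

(** Here c(q) = 0, so a small w(q) forces [p = 0] and then |w(q)| <= B |q|^-v, against the lower
    bound for [A]. Hence |w(q)| >= k for all resonant [q], and the sum is at most that of |q|^-v /
    k. *)
Lemma null_line_case (R : realType) (t : nat) (A : 'M[R]_(1 + 1, t)) (B v : R) :
  0 < B -> (1 + t)%:R < v -> usubmx A = 0 -> ~ W_plus (1 + t)%:R A ->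
  lebesgue_null [set x : 'rV[R]_1 | ((forall j, `|x ord0 j| <= B) /\ B^-1 <= `|x ord0 ord0|) /\
    W_set v (affine_map A x)].
Proof.
move=> B0 nv uA nW.
pose n : R := (1 + t)%:R; pose u := (n + v) / 2.
have n1 : 1 <= n by rewrite ler1n.
have nu : n < u by rewrite /u /n; lra.
have uv : 0 < v - u by rewrite /u /n; lra.
have u0 : 0 < u by lra.
have v0 : 0 < v by lra.
have [c c0 cP] := W_plus_lower_bound nW nu u0.
(* [Q1] makes B |q|^-(v-u) less than [c], and [Q2] makes the width |q|^-v less than 1/2. *)
have [Q1 Q11 Q1P] := @powRN_absorb R (B / c) (v - u) (divr_gt0 B0 c0) uv.
have [Q2 Q21 Q2P] := @powRN_absorb R 2 v (ltr0n R 2) v0.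
pose Q := Num.max Q1 Q2.
have QQ : 1 <= Q by rewrite le_max Q11.
pose X := [set x : 'rV[R]_1 | (forall j, `|x ord0 j| <= B) /\ B^-1 <= `|x ord0 ord0|].
have [C2 C20 C2P] := @sum_cV_powRN_le R t v nv.
(* If |w(q)| < 1, the lower part of [q] is nonzero; if |w(q)| < 1/(2B), then |x w(q)| < 1/2. *)
pose k := Num.min 1 (2 * B)^-1.
have k0 : 0 < k by rewrite lt_min ltr01 invr_gt0 mulr_gt0.
have res q : resonant A X v Q q -> k <= supnorm (form_lin A q).
  move=> [Qq [x [[xB Bx] [p pq]]]]; rewrite leNgt; apply/negP.
  rewrite lt_min => /andP[w1 wB].
  move: Qq; rewrite gt_max => /andP[/[dup] Q1q /Q1P h1 /Q2P h2].
  have q0 : 0 < supnorm (intmx R q) by lra.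
  have dq0 := form_lin_dsubmx_neq0 q0 w1.
  have cst0 : form_cst A q = 0 by rewrite /form_cst uA mul0mx mxE.
  have supE := supnorm_formE A q 0; rewrite mxE cst0 addr0 normr0 max_r ?supnorm_ge0// in supE.
  rewrite cst0 addr0 big_ord1 in pq.
  have wE : supnorm (form_lin A q) = `|form_lin A q ord0 ord0| by rewrite supnorm11.
  set w := form_lin A q ord0 ord0 in wE pq.
  have p0 : p = 0.
    apply/eqP; rewrite -normr_le0 -ltzD1 add0r -(ltr_int R) intr_norm.
    have : `|x ord0 ord0 * w| < 2^-1.
      rewrite normrM; apply: (@le_lt_trans _ _ (B * `|w|)); first by rewrite ler_wpM2r.
      by rewrite -wE mulrC -ltr_pdivlMr// -invfM.
    by move: pq; rewrite ler_norml !ltr_norml; lra.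
  rewrite p0 add0r normrM in pq.
  have wd : supnorm (form_lin A q) <= B * supnorm (intmx R q) `^ (- v).
    rewrite -ler_pdivrMl// wE; apply: le_trans pq; exact: ler_wpM2r.
  have dq := supnorm_dsubmx_le R q.
  have d0 : 0 < supnorm (intmx R (dsubmx q)) := lt_le_trans ltr01 (supnorm_intmx_ge1 R dq0).
  have := cP _ dq0 (col_mx 0 (usubmx q)); rewrite supE.
  move=> /le_trans /(_ wd); apply/negP; rewrite -ltNge.
  apply: (@le_lt_trans _ _ (B * (supnorm (intmx R q) `^ (- (v - u)) *
       supnorm (intmx R (dsubmx q)) `^ (- u)))).
    by apply: ler_wpM2l; [exact: ltW|exact: powRN_split].
  rewrite mulrA ltr_pM2r ?powR_gt0//.
  by move: h1; rewrite mulrAC ltr_pdivrMr// mul1r.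
apply: (null_of_summable (C := C2 / k) B0 (X := X) (Q := Q)) => // [x [] //|q /res|l ul lr].
  exact: lt_le_trans.
apply: (@le_trans _ _ ((\sum_(q <- l) (Num.max 1 (supnorm (intmx R q))) `^ (- v)) / k)); last first.
  by rewrite ler_pM2r ?invr_gt0// C2P.
rewrite mulr_suml big_seq [leRHS]big_seq; apply: ler_sum => q ql.
have [Qq _] := lr _ ql; have kw := res _ (lr _ ql).
rewrite max_r; last by lra.
apply: ler_wpM2l; first exact: powR_ge0.
by rewrite lef_pV2// posrE//; exact: lt_le_trans kw.
Qed.

(** * The equivalence from the two cases *)

Lemma W_set_anti (R : realType) (m k : nat) (v v' : R) (A : 'M[R]_(m, k)) :
  0 < v -> v <= v' -> W_set v' A -> W_set v A.
Proof.
move=> v0 vv' W fin; apply: W; apply: sub_finite_set fin => q [p pq]; exists p.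
apply: (le_trans pq); have [->|q0] := eqVneq q 0.
  (* The zero vector is apart: a nonzero power of 0 is 0, while other integer vectors have norm at
     least 1. *)
  have -> : supnorm (intmx R (0 : 'cV[int]_k)) = 0.
    by apply/eqP; rewrite eq_le supnorm_ge0 supnorm_leP// => i j; rewrite !mxE normr0.
  by rewrite powR0 ?powR_ge0// oppr_eq0 gt_eqF//; lra.
by rewrite ler_powR ?supnorm_intmx_ge1// lerN2.
Qed.

(** The one point that the regions |x| >= 1/B of the line case never reach. *)
Lemma null_coord0 (R : realType) : lebesgue_null [set x : 'rV[R]_1 | x ord0 ord0 = 0].
Proof.
apply/lebesgue_nullE => e e0; apply: covered_le (ltW e0) _.
have := @covered_box R 0 0 0 (fun i => lexx _).
rewrite /vol big_ord1 subrr; apply: coveredS => x /= x0 i.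
by rewrite !ord1 x0 mxE lexx.
Qed.

(** The exceptional set is exhausted by countably many pieces, indexed by one [m] that controls the
    box, the distance to 0 on the line, and the excess of the exponent over [n]. *)
Lemma extremal_affine_mapE (R : realType) (s t : nat) (A : 'M[R]_(1 + s.+1, t)) :
  t = 1%N \/ (s = 0%N /\ row ord0 A = 0) ->
  extremal (affine_map A) <-> ~ W_plus (s.+1 + t)%:R A.
Proof.
move=> tA; split=> [ext WA|nW].
  apply: (@not_null_setT R s.+1); apply: null_sub ext => x _ /=; exact: W_plus_VWA.
pose n : R := (s.+1 + t)%:R.
have bound (x : 'rV[R]_s.+1) (v : R) : n < v -> W_set v (affine_map A x) ->
    exists m : nat, [/\ supnorm x <= m.+1%:R, `|x ord0 ord0|^-1 <= m.+1%:R &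
      W_set (n + m.+1%:R^-1) (affine_map A x)].
  move=> nv Wv; have vn : 0 < v - n by lra.
  (* [T] dominates all three quantities; if the coordinate is 0, its inverse is 0 by convention. *)
  pose T := (v - n)^-1 + supnorm x + `|x ord0 ord0|^-1.
  have h1 : 0 < (v - n)^-1 by rewrite invr_gt0.
  have h2 : 0 <= `|x ord0 ord0|^-1 by rewrite invr_ge0.
  have h3 := supnorm_ge0 x.
  have T0 : 0 <= T by rewrite /T; lra.
  exists (Num.truncn T); have /andP[_ Tm] := truncn_itv T0.
  split; [by rewrite /T in Tm *; lra|by rewrite /T in Tm *; lra|].
  apply: W_set_anti Wv; first by rewrite ltr_wpDl ?ler0n// invr_gt0.
  rewrite -lerBrDl -[leRHS]invrK lef_pV2 ?posrE//.
  by rewrite /T in Tm *; lra.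
have nm m : n < n + m.+1%:R^-1 by rewrite ltrDl invr_gt0.
case: tA => [t1|[s0 A0]].
  subst t.
  apply: null_sub (null_bigcup (fun m => null_hyperplane_case (ltr0Sn R m) (nm m) nW)).
  move=> x [v [nv Wv]]; have [m [xm _ Wm]] := bound x v nv Wv.
  by exists m; split=> // j; exact: le_trans (le_entry_supnorm x ord0 j) xm.
subst s.
have uA : usubmx A = 0.
  apply/matrixP => i j; rewrite ord1 mxE [RHS]mxE.
  have := congr1 (fun M : 'rV[R]_t => M ord0 j) A0; rewrite !mxE => <-.
  by congr (A _ _); exact: val_inj.
(* Index 0 is spent on the origin, so the pieces of the line case are shifted by one. *)
pose N m := if m is m'.+1 then
  [set x : 'rV[R]_1 | ((forall j, `|x ord0 j| <= m'.+1%:R) /\ m'.+1%:R^-1 <= `|x ord0 ord0|) /\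
    W_set (n + m'.+1%:R^-1) (affine_map A x)] else [set x : 'rV[R]_1 | x ord0 ord0 = 0].
have N0 m : lebesgue_null (N m).
  case: m => [|m]; first exact: null_coord0.
  exact: (null_line_case (ltr0Sn R m) (nm m) uA nW).
apply: null_sub (null_bigcup N0) => x [v [nv Wv]].
have [x0|x0] := eqVneq (x ord0 ord0) 0; first by exists 0%N.
have [m [xm ym Wm]] := bound x v nv Wv.
exists m.+1; split=> //; split=> [j|]; first exact: le_trans (le_entry_supnorm x ord0 j) xm.
by rewrite -[leRHS]invrK lef_pV2 ?posrE// invr_gt0 normr_gt0.
Qed.

Unset Implicit Arguments.

Theorem theorem1p3 (R : realType) (n s : nat) (A : 'M[R]_(s.+1, n - s)) :
  (1 <= s)%N -> (s <= n - 1)%N ->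
  (s = (n - 1)%N \/ (s = 1%N /\ row ord0 A = 0)) ->
  (extremal (affine_map A) <-> ~ W_plus (n%:R : R) A).
Proof.
case: s A => [//|s] A _ sn H.
have nE : n = (s.+1 + (n - s.+1))%N by lia.
rewrite [X in W_plus X](_ : n%:R = (s.+1 + (n - s.+1))%:R); last by rewrite -nE.
by apply: extremal_affine_mapE; case: H => [sE|[[s0] A0]]; [left; lia|right].
Qed.
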